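(* The value function $V^{lim}_\infty$ of $(OCP)^{lim}_\infty$ satisfies the Hamilton–Jacobi–Bellman equation $$\nabla V^{lim}_\infty(x)^\top J_nx-\left|\frac{\partial V^{lim}_\infty}{\partial x_n}(x)\right|+F(x)=0$$ at every differentiability point $x\in\mathbb{R}^n$ of $V^{lim}_\infty$. Furthermore, for every initial condition $x_0\in\mathbb{R}^n$, there exists an optimal trajectory $x(\cdot)$ of $(OCP)^{lim}_\infty$ starting at $x_0$ such that the corresponding control input $u$ satisfies, for almost every $t\ge0$, $u(t)\in-\lfloor\ell_n(t)\rceil^0$ with $\ell(t)\in\partial V^{lim}_\infty(x(t))$.
   Context: Let $n\ge1$ be an integer, $J_n$ the $n\times n$ Jordan block with eigenvalue $0$ (ones on the superdiagonal, zeros elsewhere) and $e_n$ the last canonical basis vector of $\mathbb{R}^n$. The control system is $\dot x=J_nx+e_nu$. The function $F:\mathbb{R}^n\to\mathbb{R}_{\ge0}$ is continuously differentiable, convex and positive definite ($F(0)=0$, $F(x)>0$ for $x\ne0$). $(OCP)^{lim}_\infty$ is the problem of minimizing $\mathcal{K}_\infty(x_0,u)=\int_0^\infty F(x(t))\,dt$ over measurable controls $u\in L^\infty(\mathbb{R}_{\ge0},[-1,1])$, where $x(\cdot)$ is the trajectory of the control system with $x(0)=x_0$ and control $u$; $V^{lim}_\infty(x_0)=\inf_u\mathcal{K}_\infty(x_0,u)$ is its value function, which is convex. $\partial V^{lim}_\infty(x)=\{v\in\mathbb{R}^n: v^\top y\le V^{lim}_\infty(x+y)-V^{lim}_\infty(x)\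 \forall y\in\mathbb{R}^n\}$ is the subdifferential, and $\ell_n(t)$ is the $n$-th component of $\ell(t)$. For $a\in\mathbb{R}$, $\lfloor a\rceil^0=\mathrm{sgn}(a)$ denotes the set-valued sign: $\{a/|a|\}$ for $a\ne0$ and $[-1,1]$ for $a=0$. *)

(* Defs.v *)
From HB Require Import structures.
From mathcomp Require Import all_boot all_order all_algebra.
From mathcomp Require Import all_classical all_reals all_analysis.
Set Implicit Arguments.
Unset Strict Implicit.
Unset Printing Implicit Defensive.
Import Order.TTheory GRing.Theory Num.Theory.
Import numFieldNormedType.Exports.
Local Open Scope classical_set_scope.
Local Open Scope ring_scope.

(* The state space is 'cV[R]_n.+1, so that the dimension n.+1 is any positive
   integer and the last coordinate has index ord_max. *)

Section Defs.
Context {R : realType} {n : nat}.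
Local Notation state := 'cV[R]_n.+1.
Local Notation mu := (@lebesgue_measure R).

Definition jordan : 'M[R]_n.+1 := \matrix_(i, j) (j == i.+1 :> nat)%:R.

Definition e_last : state := delta_mx ord_max 0.

Definition dot (v y : state) : R := \sum_i v i 0 * y i 0.

Definition gradient (f : state -> R) (x : state) : state :=
  \col_i 'D_(delta_mx i 0) f x.

Definition C1 (f : state -> R) : Prop :=
  (forall x, differentiable f x) /\ continuous (gradient f).

Definition posdef (f : state -> R) : Prop :=
  f 0 = 0 /\ forall x, x != 0 -> 0 < f x.

(* u represents an element of L^oo([0, +oo[, [-1, 1]); only its values at
   nonnegative times matter. *)
Definition is_control (u : R -> R) : Prop :=
  measurable_fun (`[0, +oo[ : set R) u /\
  {ae mu, forall t, 0 <= t -> -1 <= u t <= 1}.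

(* Caratheodory solutions of x' = jordan x + e_last u, x(0) = x0, on
   [0, +oo[, in integral form. *)
Definition is_trajectory (x0 : state) (u : R -> R) (x : R -> state) : Prop :=
  {within (`[0, +oo[ : set R), continuous x} /\
  forall t, 0 <= t -> forall i, x t i 0 = x0 i 0 +
    \int[mu]_(s in `[0, t]) (jordan *m x s + u s *: e_last) i 0.

Definition admissible (x0 : state) (u : R -> R) (x : R -> state) : Prop :=
  is_control u /\ is_trajectory x0 u x.

Definition cost (F : state -> R) (x : R -> state) : \bar R :=
  (\int[mu]_(t in `[0%R, +oo[) (F (x t))%:E)%E.

Definition value (F : state -> R) (x0 : state) : \bar R :=
  ereal_inf [set K | exists u x, admissible x0 u x /\ K = cost F x].

(* No finiteness of value is presupposed: wherever value F is finite near x,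
   this function coincides with it near x. *)
Definition rvalue (F : state -> R) : state -> R := fine \o value F.

Definition optimal (F : state -> R) (x0 : state) (u : R -> R)
    (x : R -> state) : Prop :=
  admissible x0 u x /\ cost F x = value F x0.

Definition subdifferential (V : state -> \bar R) (x : state) : set state :=
  [set v | forall y, ((dot v y)%:E <= V (x + y)%R - V x)%E].

Definition sign_set (a : R) : set R :=
  if a == 0 then `[-1, 1]%classic else [set a / `|a|].

End Defs.

(* Main.v *)
(** The value function V is finite (a Hermite interpolation polynomial, slowed
    down enough, steers any state to 0 with an admissible control) and convex,
    so it has a subgradient at every point. If l is a subgradient of V at z, the
    trajectory that reaches z backwards in time under a constant control w gives
    l . (J z + w e) + F z >= 0 for every w in [-1, 1], while along an optimal
    trajectory V decreases at rate F, which gives l . (J x + u e) + F x <= 0 at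
    every Lebesgue point of u. Hence l . J z - |l_n| + F z = 0 for every z and
    every subgradient l at z, and u minimizes w |-> w l_n almost everywhere: no
    adjoint equation is needed, and any selection of subgradients works.
    Optimal controls exist because, the problem being convex, near-optimal
    controls of almost minimal weighted L^2 norm converge almost everywhere, by
    the parallelogram identity. *)

Require Import Defs.
From HB Require Import structures.
From mathcomp Require Import all_boot all_order all_algebra.
From mathcomp Require Import all_classical all_reals all_analysis.
From mathcomp Require Import measurable_realfun ring lra.
Import Order.TTheory GRing.Theory Num.Theory.
Import numFieldNormedType.Exports.
Local Open Scope classical_set_scope.
Local Open Scope ring_scope.
Set Implicit Arguments.
Unset Strict Implicit.
Unset Printing Implicit Defensive.

(** * Shift invariance and primitives *)

(** The subgradient inequality bounds increments of a linear form from above by increments of V.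
    Dynamic programming also bounds from above: the value at the start of a trajectory is at most
    its cost plus the value at its end. The two combine only on the increment from the end to the
    start, which is why an arbitrary constant control is run backwards into z. Forwards, the
    subgradient inequality is conclusive only where dynamic programming is an equality, that is
    along an optimal trajectory. To reach every z, that optimal trajectory has to be used at its
    initial time, which may fail to be a Lebesgue point of the control. There the averages of the
    control are only known to lie in [-1, 1], and this is enough for the inequality with -|l_n|. For
    existence, the cost alone need not single out a control, so a minimizing sequence has no reason
    to converge; the strictly convex weighted norm makes the selection. Almost everywhere
    convergence then lets each coordinate of the state pass to the limit by dominated convergence,
    and the cost by Fatou's lemma. *)

Section Shift.
Context {R : realType}.
Notation mu := (@lebesgue_measure R).
Implicit Types (a b c : R) (D : set R).

(** Typed on [measurableTypeR R] so that it can be registered as a measurable function, which makes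
    the pushforward of [mu] along it a measure. *)
Definition translation a (x : measurableTypeR R) : measurableTypeR R := x + a.

Lemma measurable_translation a :
  measurable_fun [set: measurableTypeR R] (translation a).
Proof. exact: measurable_funD. Qed.

HB.instance Definition _ a :=
  isMeasurableFun.Build _ _ _ _ _ (measurable_translation a).

Lemma lebesgue_measure_shift a D : measurable D ->
  pushforward mu (translation a) D = mu D.
Proof.
move=> mD; apply/esym/lebesgue_measure_unique => //= _ [[b c]] _ <-.
rewrite /pushforward /=.
have -> : translation a @^-1` `]b, c] = `](b - a), (c - a)]%classic.
  by apply/seteqP; split => x /=; rewrite !in_itv/= ltrBlDr lerBrDr.
rewrite !lebesgue_measure_itv/= !lte_fin ltrD2r; case: ifP => // _.
by rewrite -!EFinD; congr _%:E; ring.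
Qed.

Lemma ge0_integral_shift a D (f : R -> \bar R) : measurable D ->
  measurable_fun D f -> (forall x, D x -> 0 <= f x)%E ->
  (\int[mu]_(x in D) f x =
   \int[mu]_(x in (fun x => (x + a)%R) @^-1` D) f (x + a)%R)%E.
Proof.
move=> mD mf f0.
rewrite integral_mkcond [RHS]integral_mkcond.
transitivity (\int[pushforward mu (translation a)]_x (f \_ D) x)%E.
  by apply: eq_measure_integral => A mA _; exact/esym/lebesgue_measure_shift.
rewrite ge0_integral_pushforward//=; last 2 first.
  exact/(measurable_restrictT f mD).
  by move=> x _; rewrite patchE; case: ifP => // /set_mem /f0.
Qed.

Lemma integral_shift a D (f : R -> \bar R) : measurable D ->
  measurable_fun D f ->
  (\int[mu]_(x in D) f x =
   \int[mu]_(x in (fun x => (x + a)%R) @^-1` D) f (x + a)%R)%E.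
Proof.
move=> mD mf; rewrite integralE [RHS]integralE.
rewrite -[fun x => f (x + a)%R]/(f \o translation a).
rewrite [in RHS]funepos_comp [in RHS]funeneg_comp.
congr (_ - _)%E.
  by rewrite (ge0_integral_shift a mD (measurable_funepos mf)).
by rewrite (ge0_integral_shift a mD (measurable_funeneg mf)).
Qed.

Lemma shift_itvcc a b c :
  (fun x => (x + a)%R) @^-1` `[b, c] = `[(b - a), (c - a)]%classic.
Proof. by apply/seteqP; split => x /=; rewrite !in_itv/= lerBlDr lerBrDr. Qed.

Lemma shift_itvcy a b :
  (fun x => (x + a)%R) @^-1` `[b, +oo[ = `[(b - a), +oo[%classic.
Proof. by apply/seteqP; split => x /=; rewrite !in_itv/= lerBlDr. Qed.

Lemma measurable_fun_shift d (T : measurableType d) a D (f : R -> T) : measurable D ->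
  measurable_fun D f ->
  measurable_fun ((fun x => (x + a)%R) @^-1` D) (fun x => f (x + a)).
Proof.
move=> mD mf.
apply: (measurable_comp mD) => //.
  by move=> _ [x ? <-].
by apply: measurable_funTS; exact: measurable_translation.
Qed.

Lemma integrable_shift a D (f : R -> R) : measurable D ->
  mu.-integrable D (EFin \o f) ->
  mu.-integrable ((fun x => (x + a)%R) @^-1` D) (EFin \o (fun x => f (x + a))).
Proof.
move=> mD /integrableP[mf fi]; apply/integrableP; split.
  exact: (measurable_fun_shift _ mf).
rewrite -(integral_shift a (f := fun x => `|(f x)%:E|%E))//.
exact: measurableT_comp.
Qed.

Lemma Rintegral_shift a D (f : R -> R) : measurable D ->
  measurable_fun D f ->
  \int[mu]_(x in D) f x = \int[mu]_(x in (fun x => x + a) @^-1` D) f (x + a).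
Proof.
move=> mD mf; rewrite /Rintegral (integral_shift a)//.
exact/measurable_EFinP.
Qed.

End Shift.

Section Primitive.
Context {R : realType}.
Notation mu := (@lebesgue_measure R).
Implicit Types (f g : R -> R) (c t T S : R).

(** The Caratheodory form of [g' = f], [g 0 = c] on [0, T]. Integrability is included because the
    real-valued integral of a non-integrable function carries no information. *)
Definition primitive T c f g := mu.-integrable `[0, T] (EFin \o f) /\
  forall t, 0 <= t <= T -> g t = c + \int[mu]_(s in `[0, t]) f s.

Lemma subset_itv0 t T : t <= T -> `[0, t] `<=` `[0, T].
Proof. by move=> tT; apply: subset_itvl; rewrite bnd_simp. Qed.

Lemma primitiveW T S c f g : T <= S -> primitive S c f g -> primitive T c f g.
Proof.
move=> TS [fi fg]; split; first by apply: integrableS fi => //; exact: subset_itv0.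
by move=> t /andP[t0 tT]; apply: fg; rewrite t0 (le_trans tT).
Qed.

Lemma primitive0 T c f g : 0 <= T -> primitive T c f g -> g 0 = c.
Proof. by move=> T0 [_ ->]; rewrite ?lexx// set_itv1 Rintegral_set1 addr0. Qed.

Lemma primitiveB T c f g s t : primitive T c f g -> 0 <= s -> s <= t -> t <= T ->
  g t - g s = \int[mu]_(r in `[s, t]) f r.
Proof.
move=> [fi fg] s0 st tT.
have t0 := le_trans s0 st.
rewrite !fg ?s0 ?t0 ?tT ?(le_trans st)// opprD addrACA subrr add0r.
have fit : mu.-integrable `[0, t] (EFin \o f).
  by apply: integrableS fi => //; exact: subset_itv0.
rewrite Rintegral_itvB ?bnd_simp//.
rewrite Rintegral_itv_obnd_cbnd//.
apply: integrableS fit => //; apply: subset_itvr.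
by rewrite bnd_simp.
Qed.

Lemma primitive_continuous T c f g : 0 <= T -> primitive T c f g ->
  {within `[0, T], continuous g}.
Proof.
move=> T0 [fi fg].
pose h (t : R) : R := \int[mu]_(s in `[0, t]) f s.
have hc := parameterized_integral_continuous T0 fi.
have gE : {in `[0, T], (fun t => c + h t) =1 g}.
  by move=> t; rewrite in_itv/= => /fg.
apply: (subspace_eq_continuous (f := fun t => c + h t)).
  by move=> x /set_mem /=; exact: gE.
move=> x; apply: cvgD; first exact: cvg_cst.
exact: (hc x).
Qed.

Lemma primitive_shift T S c f g : 0 <= T -> 0 <= S -> primitive (T + S) c f g ->
  primitive S (g T) (fun t => f (t + T)) (fun t => g (t + T)).
Proof.
move=> T0 S0 pr; have [fi fg] := pr.
have mT t : 0 <= t -> t <= S ->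
    mu.-integrable `[0, t] (EFin \o (fun t => f (t + T))) /\
    \int[mu]_(s in `[0, t]) f (s + T) = \int[mu]_(s in `[T, t + T]) f s.
  move=> t0 tS.
  have fi' : mu.-integrable `[T, t + T] (EFin \o f).
    apply: integrableS fi => //; apply: subset_itvScc; rewrite ?bnd_simp//.
    by rewrite addrC lerD2l.
  split.
    have := integrable_shift T _ fi'.
    by rewrite shift_itvcc subrr addrK; exact.
  rewrite [RHS](Rintegral_shift T)//.
    by rewrite shift_itvcc subrr addrK.
  by case/integrableP: fi' => /measurable_EFinP.
split; first by case: (mT S).
move=> t /andP[t0 tS]; have [_ ->] := mT t t0 tS.
rewrite -(primitiveB pr)//; first by rewrite [RHS]addrC subrK.
  by rewrite -[leLHS]add0r lerD2r.
by rewrite addrC lerD2l.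
Qed.

Definition splice T (A : Type) (f g : R -> A) t := if t <= T then f t else g (t - T).

Lemma integrable_splice T S f f' : 0 <= T -> 0 <= S ->
  mu.-integrable `[0, T] (EFin \o f) ->
  mu.-integrable `[0, S] (EFin \o f') ->
  mu.-integrable `[0, T + S] (EFin \o splice T f f').
Proof.
move=> T0 S0 fi fi'.
have fi'' : mu.-integrable `]T, T + S] (EFin \o (fun x => f' (x - T))).
  apply: (@integrableS _ _ _ mu `[T, T + S]) => //.
    by apply: subset_itvr; rewrite bnd_simp.
  have := integrable_shift (- T) (_ : measurable `[0, S]) fi'.
  by rewrite shift_itvcc opprK add0r [S + T]addrC; exact.
have -> : `[0, T + S]%classic = `[0, T] `|` `]T, T + S].
  by rewrite -itv_bndbnd_setU ?bnd_simp// lerDl.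
have dAB : [disjoint `[0, T]%classic & `]T, T + S]%classic].
  apply/disj_setPS => y [/=]; rewrite !in_itv/= => /andP[_ yT] /andP[].
  by rewrite ltNge yT.
have mg : measurable_fun (`[0, T] `|` `]T, T + S]) (EFin \o splice T f f').
  apply/measurable_EFinP/measurable_funU => //; split.
    apply: (eq_measurable_fun f).
      by move=> x /set_mem /=; rewrite in_itv/= /splice => /andP[_ ->].
    by case/integrableP : fi => /measurable_EFinP.
  apply: (eq_measurable_fun (fun x : R => f' (x - T) : R)).
    by move=> x /set_mem /=; rewrite in_itv/= => /andP[Tx _]; rewrite /splice leNgt Tx.
  by case/integrableP : fi'' => /measurable_EFinP.
apply/integrableP; split => //.
rewrite ge0_integral_setU//=; last first.
  move/measurable_EFinP: mg => mg; apply/measurable_EFinP.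
  exact: measurableT_comp.
apply: lte_add_pinfty.
  have -> : (\int[mu]_(x in `[0%R, T]) `|splice T f f' x|%:E =
      \int[mu]_(x in `[0%R, T]) `|(f x)%:E|)%E.
    apply: eq_integral => x /set_mem /=.
    by rewrite in_itv/= /splice => /andP[_ ->].
  by case/integrableP: fi.
have -> : (\int[mu]_(x in `]T, (T + S)%R]) `|splice T f f' x|%:E =
    \int[mu]_(x in `]T, (T + S)%R]) `|(f' (x - T)%R)%:E|)%E.
  apply: eq_integral => x /set_mem /=.
  by rewrite in_itv/= => /andP[Tx _]; rewrite /splice leNgt Tx.
by case/integrableP: fi''.
Qed.

Lemma primitive_splice T S c f f' g g' : 0 <= T -> 0 <= S ->
  primitive T c f g -> primitive S (g T) f' g' ->
  primitive (T + S) c (splice T f f') (splice T g g').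
Proof.
move=> T0 S0 pr pr'; have [fi fg] := pr; have [fi' fg'] := pr'.
have gi := integrable_splice T0 S0 fi fi'; split => // t /andP[t0 tTS].
rewrite {1}/splice; case: leP => tT.
  rewrite fg ?t0//; congr (_ + _); apply: eq_Rintegral => x /set_mem /=.
  by rewrite in_itv/= /splice => /andP[_ /le_trans ->].
have tT0 : 0 <= t - T by rewrite subr_ge0 ltW.
have tTS' : t - T <= S by rewrite lerBlDl.
rewrite fg' ?tT0// (fg T) ?T0 ?lexx// -addrA; congr (_ + _).
have gi0 : mu.-integrable `[0, t] (EFin \o splice T f f').
  by apply: integrableS gi => //; exact: subset_itv0.
apply/esym/eqP; rewrite addrC -subr_eq; apply/eqP.
have -> : \int[mu]_(s in `[0, T]) f s = \int[mu]_(s in `[0, T]) splice T f f' s.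
  by apply: eq_Rintegral => x /set_mem /=; rewrite in_itv/= /splice => /andP[_ ->].
rewrite Rintegral_itvB ?bnd_simp ?(ltW tT)//.
rewrite (Rintegral_shift (- T) (_ : measurable `[0, t - T])); last 2 first.
- by [].
- case/integrableP: fi' => /measurable_EFinP mf' _.
  by apply: measurable_funS mf' => //; exact: subset_itv0.
rewrite shift_itvcc opprK add0r subrK.
rewrite -Rintegral_itv_obnd_cbnd.
  apply: eq_Rintegral => x /set_mem /=; rewrite in_itv/=.
  by move=> /andP[Tx _]; rewrite /splice leNgt Tx.
apply: (@eq_integrable _ _ _ mu _ _ (EFin \o splice T f f')) => //.
  by move=> x /set_mem /=; rewrite in_itv/= => /andP[Tx _]; rewrite /splice leNgt Tx.
apply: integrableS gi0 => //.
by apply: subset_itv; rewrite bnd_simp.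
Qed.

Lemma primitive_comb T a b c c' f f' g g' : primitive T c f g -> primitive T c' f' g' ->
  primitive T (a * c + b * c') (fun t => a * f t + b * f' t)
    (fun t => a * g t + b * g' t).
Proof.
move=> [fi fg] [fi' fg'].
have iZ t k h : mu.-integrable `[0, t] (EFin \o h) ->
    mu.-integrable `[0, t] (EFin \o (fun t => k * h t)).
  move=> hi; have : mu.-integrable `[0, t] (fun x => k%:E * (EFin \o h) x)%E.
    exact: integrableZl.
  by apply: eq_integrable => // x _ /=; rewrite EFinM.
split.
  apply: (@eq_integrable _ _ _ mu _ _
    ((EFin \o (fun t => a * f t)%R) \+ (EFin \o (fun t => b * f' t)%R))%E) => //.
  by apply: integrableD => //; exact: iZ.
move=> t /andP[t0 tT].
have ti : mu.-integrable `[0, t] (EFin \o f).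
  by apply: integrableS fi => //; exact: subset_itv0.
have ti' : mu.-integrable `[0, t] (EFin \o f').
  by apply: integrableS fi' => //; exact: subset_itv0.
rewrite fg ?t0// fg' ?t0// RintegralD//; try exact: iZ.
by rewrite !RintegralZl//; ring.
Qed.

Lemma eq_primitive T c f f' g g' : {in `[0, T], f =1 f'} -> {in `[0, T], g =1 g'} ->
  primitive T c f g -> primitive T c f' g'.
Proof.
move=> ff gg [fi fg]; split.
  apply: eq_integrable fi => // x /set_mem /= xT.
  by rewrite ff.
move=> t tT; rewrite -gg// fg//; congr (_ + _); apply: eq_Rintegral => x.
move=> /set_mem /=; rewrite in_itv/= => /andP[x0 xt]; apply: ff.
by rewrite in_itv/= x0 (le_trans xt)//; case/andP: tT.
Qed.

End Primitive.

(** * Trajectories *)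

Lemma cvg_col (R : realType) n (A : Type) (G : set_system A) {FG : Filter G}
    (x : A -> 'cV[R]_n) (l : 'cV[R]_n) :
  (forall i, x t i 0 @[t --> G] --> l i 0) -> x @ G --> l.
Proof.
move=> xl; apply/cvg_ballP => e e0.
have : \forall t \near G, forall i, ball (l i 0) e (x t i 0).
  apply: filter_forall => i; have /cvg_ballP := xl i.
  by move=> /(_ e e0).
apply: filterS => t xt; split => // i j.
by rewrite ord1; exact: xt.
Qed.

Lemma within_continuous_ray (R : realType) (g : R -> R) :
  (forall T, 0 <= T -> {within `[0, T], continuous g}) ->
  {within `[0, +oo[, continuous g}.
Proof.
move=> gc; apply/continuous_within_itvcyP; split.
  move=> t; rewrite in_itv/= andbT => t0.
  have t10 : 0 < t + 1 by rewrite addr_gt0.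
  have /continuous_within_itvP[//|+ _ _] := gc _ (ltW t10); apply.
  by rewrite in_itv/= t0 ltrDl ltr01.
have /continuous_within_itvP[//|_ + _] := gc _ (@ler01 R).
exact.
Qed.

Lemma ae_imply (R : realType) (P Q : R -> Prop) : (forall t, P t -> Q t) ->
  {ae @lebesgue_measure R, forall t, P t} ->
  {ae @lebesgue_measure R, forall t, Q t}.
Proof.
move=> PQ; apply: filterS; last exact: PQ.
exact: (ae_filter_ringOfSetsType (@lebesgue_measure R)).
Qed.

Section Trajectories.
Context {R : realType} {n : nat}.
Notation state := 'cV[R]_n.+1.
Notation mu := (@lebesgue_measure R).
Implicit Types (x y : R -> state) (u v : R -> R) (p q : state) (T S t : R).

(** A representative of a control that is measurable and bounded at every time, so that midpoints,
    splices and limits can be formed pointwise without exceptional sets. *)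
Definition good_control u :=
  measurable_fun [set: R] u /\ forall t, -1 <= u t <= 1.

Definition velocity (z : state) (w : R) (i : 'I_n.+1) : R :=
  (jordan *m z + w *: e_last) i 0.

Lemma velocityE z w i :
  velocity z w i = if (i < n)%N then z (inord i.+1) 0 else w.
Proof.
rewrite /velocity !mxE; case: ltnP => iN.
  rewrite (bigD1 (inord i.+1 : 'I_n.+1)) //= big1 => [|j ji].
    by rewrite !mxE inordK// eqxx mul1r -val_eqE /= (ltn_eqF iN) mulr0 !addr0.
  rewrite mxE; case: eqP => [e|]; last by rewrite mul0r.
  by case/eqP: ji; apply/val_inj; rewrite /= e inordK.
have -> : i = ord_max by apply/val_inj/eqP; rewrite eqn_leq iN -ltnS ltn_ord.
rewrite big1 ?eqxx ?mulr1 ?add0r// => j _.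
by rewrite mxE /= ltn_eqF ?mul0r// ltn_ord.
Qed.

Definition solves T p u x := forall i,
  primitive T (p i 0) (fun s => velocity (x s) (u s) i) (fun s => x s i 0).

Lemma solvesW T S p u x : T <= S -> solves S p u x -> solves T p u x.
Proof. by move=> TS sx i; exact: primitiveW TS (sx i). Qed.

Lemma solves_start T p u x : 0 <= T -> solves T p u x -> x 0 = p.
Proof. by move=> T0 sx; apply/colP => i; exact: primitive0 (sx i). Qed.

Lemma solves_coord_continuous p u x : (forall T, 0 <= T -> solves T p u x) ->
  forall i : 'I_n.+1, {within `[0, +oo[, continuous (fun t => x t i 0)}.
Proof.
move=> sx i; apply: within_continuous_ray => T T0.
exact: primitive_continuous T0 (sx T T0 i).
Qed.

Lemma solves_continuous p u x : (forall T, 0 <= T -> solves T p u x) ->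
  {within `[0, +oo[, continuous x}.
Proof.
move=> sx; apply/subspace_continuousP => t t0; apply: cvg_col => i.
by move/subspace_continuousP: (solves_coord_continuous sx (i := i)); apply.
Qed.

Lemma solves_admissible p u x : good_control u ->
  (forall T, 0 <= T -> solves T p u x) -> admissible p u x.
Proof.
move=> [mu_u u1] sx; split; last first.
  split; first exact: solves_continuous sx.
  by move=> t t0 i; have [_ ->] := sx t t0 i; rewrite ?t0 ?lexx.
split; first exact: measurable_funTS.
by apply: aeW => t _; exact: u1.
Qed.

Lemma good_control_integrable u T : good_control u ->
  mu.-integrable `[0, T] (EFin \o u).
Proof.
move=> [mu_u u1]; apply: measurable_bounded_integrable => //.
- rewrite /= lebesgue_measure_itv/=; case: ifP => // _.
  by rewrite -EFinB ltry.
- exact: measurable_funTS.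
exists 1; split; first exact: num_real.
by move=> M M1 t _ /=; apply: le_trans (ltW M1); rewrite ler_norml u1.
Qed.

Lemma admissible_coord_continuous p u x i : admissible p u x ->
  {within `[0, +oo[, continuous (fun t => x t i 0)}.
Proof.
move=> [_ [xc _]]; apply/subspace_continuousP => t t0.
move/subspace_continuousP: xc => /(_ t t0) xt.
exact: (cvg_comp _ _ xt (@coord_continuous R n.+1 1 i 0 (x t))).
Qed.

Lemma ray_integrable (g : R -> R) T : {within `[0, +oo[, continuous g} ->
  mu.-integrable `[0, T] (EFin \o g).
Proof.
move=> gc; apply: continuous_compact_integrable; first exact: segment_compact.
apply: continuous_subspaceW gc.
by apply: subset_itvl; rewrite bnd_simp.
Qed.

(** Setting [u] to 0 at negative times and wherever it leaves [-1, 1] alters it, on the half-line,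
    only on a null set. The integrals do not see the change, so [x] itself still solves the
    system. *)
Lemma admissible_good p u x : admissible p u x ->
  exists v, good_control v /\ (forall T, 0 <= T -> solves T p v x) /\
    {ae mu, forall t, 0 <= t -> u t = v t}.
Proof.
move=> ad; have [[mu_u u1] [xc xE]] := ad.
pose D := (`[0, +oo[ : set R) `&` u @^-1` `[-1, 1].
have mD : measurable D by apply: mu_u.
pose v := u \_ D.
have vg : good_control v.
  split.
    apply/(measurable_restrictT u mD).
    by apply: measurable_funS mu_u => //; exact: subIsetl.
  move=> t; rewrite /v patchE; case: ifPn => [/set_mem[_]|_].
    by rewrite /= in_itv.
  by rewrite lerN10 ler01.
have uv : {ae mu, forall t, 0 <= t -> u t = v t}.
  apply: ae_imply u1 => t + t0; move=> /(_ t0) ut.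
  rewrite /v patchE mem_set//; split => /=; first by rewrite in_itv/= t0.
  by rewrite in_itv.
exists v; split => //; split => // T T0 i.
have vi : mu.-integrable `[0, T] (EFin \o fun s => velocity (x s) (v s) i).
  have [iN|iN] := ltnP i n.
    apply: (@eq_integrable _ _ _ mu _ _ (EFin \o fun t => x t (inord i.+1) 0)) => //.
      by move=> s _ /=; rewrite velocityE iN.
    exact: (ray_integrable _ (admissible_coord_continuous (i := inord i.+1) ad)).
  apply: (@eq_integrable _ _ _ mu _ _ (EFin \o v)) => //.
    by move=> s _ /=; rewrite velocityE ltnNge iN.
  exact: good_control_integrable.
split => // t /andP[t0 tT]; rewrite xE//; congr (_ + _).
have [iN|iN] := ltnP i n.
  apply: eq_Rintegral => s _.
  by rewrite -!/(velocity _ _ _) !velocityE iN.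
congr fine; apply: ae_eq_integral => //.
- apply/measurable_EFinP.
  apply: (eq_measurable_fun u).
    by move=> s _; rewrite -!/(velocity _ _ _) velocityE ltnNge iN.
  apply: measurable_funS mu_u => //.
  by apply: subset_itvl; rewrite bnd_simp.
- have /integrableP[+ _] := vi; apply: measurable_funS => //.
  exact: subset_itv0.
- apply: ae_imply uv => s + /=; rewrite in_itv/= => + /andP[s0 _].
  by move=> /(_ s0) ->.
Qed.

Lemma solves_comb T p q u v x y a b : solves T p u x -> solves T q v y ->
  solves T (a *: p + b *: q) (fun t => a * u t + b * v t)
    (fun t => a *: x t + b *: y t).
Proof.
move=> sx sy i; have := primitive_comb a b (sx i) (sy i).
rewrite !mxE; apply: eq_primitive => t _; last by rewrite !mxE.
by rewrite !velocityE; case: ltnP => // _; rewrite !mxE.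
Qed.

Lemma solves_shift T S p u x : 0 <= T -> 0 <= S -> solves (T + S) p u x ->
  solves S (x T) (fun t => u (t + T)) (fun t => x (t + T)).
Proof. by move=> T0 S0 sx i; exact: primitive_shift T0 S0 (sx i). Qed.

Lemma solves_splice T S p u v x y : 0 <= T -> 0 <= S ->
  solves T p u x -> solves S (x T) v y ->
  solves (T + S) p (splice T u v) (splice T x y).
Proof.
move=> T0 S0 sx sy i; have := primitive_splice T0 S0 (sx i) (sy i).
by apply: eq_primitive => t _; rewrite /splice; case: leP.
Qed.

(** [splice T u v] itself follows [u] at negative times, where nothing is known of [u]; the witness
    is 0 there and is written as a sum of two zero extensions with disjoint supports. *)
Lemma good_control_splice T u v : 0 <= T -> measurable_fun `[0, T] u ->
  (forall t, 0 <= t <= T -> -1 <= u t <= 1) -> good_control v ->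
  exists w, good_control w /\ forall t, 0 <= t -> w t = splice T u v t.
Proof.
move=> T0 mu_u u1 [mv v1].
pose D := `]T, +oo[%classic : set R.
have mD : measurable D by exact: measurable_itv.
exists (fun t => (u \_ `[0, T]) t + ((fun t => v (t - T)) \_ D) t); split.
  split.
    apply: measurable_funD.
      exact/(measurable_restrictT u).
    apply/(measurable_restrictT (fun t => v (t - T)) mD); apply: measurable_funTS.
    apply: measurableT_comp => //.
    exact: (@measurable_translation R (- T)).
  move=> t; rewrite !patchE; case: ifPn => [/set_mem /=|].
    rewrite in_itv/= => tT; rewrite memNset ?addr0 ?u1//.
    by rewrite /D /= in_itv/= andbT; apply/negP; rewrite -leNgt; case/andP: tT.
  by move=> _; rewrite add0r; case: ifP => // _; rewrite ?v1// lerN10 ler01.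
move=> t t0; rewrite !patchE /splice; case: leP => tT.
  rewrite mem_set; last by rewrite /= in_itv/= t0.
  by rewrite memNset ?addr0// /D /= in_itv/= ltNge tT.
rewrite memNset; last by rewrite /= in_itv/= t0 leNgt tT.
by rewrite mem_set ?add0r// /D /= in_itv/= tT.
Qed.

Lemma eq_solves T p u v x y : {in `[0, T], u =1 v} -> {in `[0, T], x =1 y} ->
  solves T p u x -> solves T p v y.
Proof.
move=> uv xy sx i; apply: eq_primitive (sx i) => t tT; last by rewrite xy.
by rewrite uv// xy.
Qed.

End Trajectories.

(** * Cost and dynamic programming *)

Section Cost.
Context {R : realType} {n : nat}.
Notation state := 'cV[R]_n.+1.
Notation mu := (@lebesgue_measure R).
Implicit Types (x y : R -> state) (u v : R -> R) (p q : state) (T S t : R).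
Variable F : state -> R.
Hypothesis Fcont : continuous F.
Hypothesis F0 : F 0 = 0.
Hypothesis Fge0 : forall z, 0 <= F z.

Lemma running_cost_continuous x : {within `[0, +oo[, continuous x} ->
  {within `[0, +oo[, continuous (F \o x)}.
Proof.
move=> xc; apply/subspace_continuousP => t t0.
move/subspace_continuousP: xc => /(_ t t0) xt.
by apply: cvg_comp; [exact: xt|exact: Fcont].
Qed.

Lemma running_cost_integrable T x : {within `[0, +oo[, continuous x} ->
  mu.-integrable `[0, T] (EFin \o (F \o x)).
Proof. by move=> xc; exact/ray_integrable/running_cost_continuous. Qed.

Lemma running_cost_measurable x : {within `[0, +oo[, continuous x} ->
  measurable_fun (`[0, +oo[ : set R) (F \o x).
Proof.
move=> xc; apply: subspace_continuous_measurable_fun => //.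
exact: running_cost_continuous.
Qed.

Definition cost_on T x : R := \int[mu]_(t in `[0, T]) F (x t).

Lemma cost_ge0 x : (0 <= cost F x)%E.
Proof. by apply: integral_ge0 => t _; rewrite lee_fin. Qed.

Lemma EFin_cost_on T x : {within `[0, +oo[, continuous x} ->
  (cost_on T x)%:E = (\int[mu]_(t in `[0%R, T]) (F (x t))%:E)%E.
Proof.
move=> xc; rewrite /cost_on /Rintegral fineK//.
by apply: integrable_fin_num => //; exact: running_cost_integrable.
Qed.

Lemma cost_split T x : 0 <= T -> {within `[0, +oo[, continuous x} ->
  cost F x = ((cost_on T x)%:E + cost F (fun t => x (t + T)%R))%E.
Proof.
move=> T0 xc; have mF := running_cost_measurable xc.
rewrite EFin_cost_on// {1}/cost.
have -> : `[0, +oo[%classic = `[0, T] `|` `]T, +oo[ :> set R.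
  by rewrite -itv_bndbnd_setU ?bnd_simp.
rewrite ge0_integral_setU//=; last first.
- apply/disj_setPS => y [/=]; rewrite !in_itv/= andbT => /andP[_ yT].
  by rewrite ltNge yT.
- by move=> t _; rewrite lee_fin.
- rewrite -itv_bndbnd_setU ?bnd_simp//.
  exact/measurable_EFinP.
congr (_ + _)%E.
rewrite integral_itv_obnd_cbnd; last first.
  apply/measurable_EFinP; apply: measurable_funS mF => //.
  by apply: subset_itvr; rewrite bnd_simp.
rewrite (ge0_integral_shift T)//.
- by rewrite shift_itvcy subrr.
- apply/measurable_EFinP; apply: measurable_funS mF => //.
  by apply: subset_itvr; rewrite bnd_simp.
- by move=> t _; rewrite lee_fin.
Qed.

Lemma eq_cost x y : (forall t, 0 <= t -> x t = y t) -> cost F x = cost F y.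
Proof.
move=> xy; apply: eq_integral => t /set_mem /=.
by rewrite in_itv/= andbT => /xy ->.
Qed.

Lemma value_ge0 p : (0 <= value F p)%E.
Proof. by apply: le_ereal_inf_tmp => _ [u [x [_ ->]]]; exact: cost_ge0. Qed.

Lemma value_le_cost p u x : admissible p u x -> (value F p <= cost F x)%E.
Proof. by move=> ad; apply: ereal_inf_lbound; exists u, x. Qed.

Lemma admissible_continuous p u x : admissible p u x ->
  {within `[0, +oo[, continuous x}.
Proof. by case=> _ []. Qed.

Lemma admissible_shift T p u x : 0 <= T -> admissible p u x ->
  exists v, admissible (x T) v (fun t => x (t + T)).
Proof.
move=> T0 /admissible_good[v [[mv v1] [sx _]]].
exists (fun t => v (t + T)); apply: solves_admissible.
  split; last by move=> t; exact: v1.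
  apply: measurableT_comp => //.
  exact: (@measurable_translation R T).
move=> S S0; apply: solves_shift => //; apply: sx; exact: addr_ge0.
Qed.

Lemma admissible_splice T p u v x y : 0 <= T -> measurable_fun (`[0, T] : set R) u ->
  (forall t, 0 <= t <= T -> -1 <= u t <= 1) -> solves T p u x ->
  admissible (x T) v y -> exists w, admissible p w (splice T x y).
Proof.
move=> T0 mu_u u1 sx /admissible_good[v' [vg [sy _]]].
have [w [wg wE]] := good_control_splice T0 mu_u u1 vg.
exists w; apply: solves_admissible => // S S0.
have := solves_splice T0 S0 sx (sy S S0).
move=> /(solvesW (_ : S <= T + S)); rewrite lerDr => /(_ T0).
apply: eq_solves => // t; rewrite in_itv/= => /andP[t0 _].
by rewrite wE.
Qed.

Lemma admissible_start p u x : admissible p u x -> x 0 = p.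
Proof. by move=> /admissible_good[v [_ [sx _]]]; exact: solves_start (sx 0 _). Qed.

Lemma cost_splice T x y : 0 <= T -> {within `[0, +oo[, continuous splice T x y} ->
  x T = y 0 -> cost F (splice T x y) = ((cost_on T x)%:E + cost F y)%E.
Proof.
move=> T0 sc xy; rewrite (cost_split T0 sc); congr (_%:E + _)%E.
  apply: eq_Rintegral => t /set_mem /=.
  by rewrite in_itv/= /splice => /andP[_ ->].
(* At [t = 0] the splice still reads [x T]; only the hypothesis [x T = y 0] identifies it with the
   start of [y]. *)
apply: eq_cost => t; rewrite le_eqVlt => /predU1P[<-|t0].
  by rewrite /splice add0r lexx.
by rewrite /splice leNgt addrC ltrDl t0 /= addrAC subrr add0r.
Qed.

(** Any continuation from [x T] can be spliced after [x]. The control is constrained on [0, T] only,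
    so polynomial controls, unbounded on the line, are allowed. *)
Lemma dynamic_programming T p u x : 0 <= T -> measurable_fun (`[0, T] : set R) u ->
  (forall t, 0 <= t <= T -> -1 <= u t <= 1) -> solves T p u x ->
  (value F p <= (cost_on T x)%:E + value F (x T))%E.
Proof.
move=> T0 mu_u u1 sx; rewrite -leeBlDl//.
apply: le_ereal_inf_tmp => _ [v [y [ad ->]]]; rewrite leeBlDl//.
have [w adw] := admissible_splice T0 mu_u u1 sx ad.
rewrite -cost_splice//.
- exact: value_le_cost adw.
- exact: admissible_continuous adw.
- by rewrite (admissible_start ad).
Qed.

(** A cheaper continuation from [x T] would improve on [x]: the real number [cost_on F T x] cancels
    from both sides of the dynamic programming inequality. *)
Lemma optimal_tail T p u x : 0 <= T -> optimal F p u x ->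
  (value F p < +oo)%E -> value F (x T) = cost F (fun t => x (t + T)).
Proof.
move=> T0 [ad cx] fin.
have [v [[mv v1] [sx _]]] := admissible_good ad.
apply/eqP; rewrite eq_le; apply/andP; split.
  have [w adw] := admissible_shift T0 ad; exact: value_le_cost adw.
have := dynamic_programming T0 (measurable_funTS mv) (fun t _ => v1 t) (sx T T0).
by rewrite -cx (cost_split T0 (admissible_continuous ad)) leeD2lE.
Qed.

Lemma optimal_decrease T S p u x : 0 <= T -> 0 <= S -> optimal F p u x ->
  (value F p < +oo)%E ->
  value F (x T) =
    ((\int[mu]_(t in `[T, (T + S)%R]) F (x t))%:E + value F (x (T + S)%R))%E.
Proof.
move=> T0 S0 op fin; have [ad _] := op.
rewrite (optimal_tail T0 op fin) (optimal_tail (addr_ge0 T0 S0) op fin).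
have [w adw] := admissible_shift T0 ad.
rewrite (cost_split S0 (admissible_continuous adw)); congr (_%:E + _)%E.
  rewrite /cost_on [RHS](Rintegral_shift T)//.
    by rewrite shift_itvcc subrr addrC addKr.
  have := running_cost_measurable (admissible_continuous ad).
  apply: measurable_funS => //.
  by apply: subset_itv; rewrite bnd_simp.
by apply: eq_cost => t _; rewrite -addrA [(S + T)%R]addrC.
Qed.

End Cost.

(** * Polynomial trajectories and null controllability *)

Section PolyFacts.
Context {R : realType}.
Implicit Types (p q : {poly R}) (c t : R).

Lemma derivn_at0 p j : p^`(j).[0] = p`_j *+ j`!.
Proof. by rewrite horner_coef0 coef_derivn addn0 ffactnn. Qed.

Lemma derivn_comp_affine p a b j :
  (p \Po (a *: 'X + b%:P))^`(j) = a ^+ j *: (p^`(j) \Po (a *: 'X + b%:P)).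
Proof.
elim: j => [|j IH]; first by rewrite expr0 scale1r.
rewrite derivnS IH derivZ deriv_comp derivD derivC addr0 derivZ derivX.
rewrite -derivnS mulrC -scalerAl mul1r scalerA exprSr.
by [].
Qed.

Lemma derivn_multiple_root c p k j : (j < k)%N ->
  ((('X - c%:P) ^+ k) * p)^`(j).[c] = 0.
Proof.
move=> jk.
(* Each differentiation costs at most one factor ['X - c%:P]. *)
have [q ->] : exists q, ((('X - c%:P) ^+ k) * p)^`(j) = ('X - c%:P) ^+ (k - j) * q.
  elim: j jk => [|j IH] jk; first by exists p; rewrite subn0.
  have [q IHq] := IH (ltnW jk).
  exists ((k - j)%:R *: q + ('X - c%:P) * q^`()).
  rewrite derivnS IHq derivM deriv_exp derivB derivX derivC subr0 mul1r.
  have -> : (k - j = (k - j.+1).+1)%N by rewrite (subnSK (ltnW jk)).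
  by rewrite /= mulrDr exprSr scaler_nat mulrA mulrnAl mulrnAr.
by rewrite hornerM horner_exp !hornerE subrr expr0n subn_eq0 leqNgt jk mul0r.
Qed.

Lemma poly_integral p t : 0 <= t ->
  \int[@lebesgue_measure R]_(s in `[0, t]) p^`().[s] = p.[t] - p.[0].
Proof.
rewrite le_eqVlt => /predU1P[<-|t0].
  by rewrite set_itv1 Rintegral_set1 subrr.
rewrite /Rintegral (@continuous_FTC2 R _ (horner p))//.
- apply: continuous_subspaceT => s; exact: continuous_horner.
- split.
  + by move=> s _; exact: derivable_horner.
  + by apply: cvg_at_right_filter; exact: continuous_horner.
  + by apply: cvg_at_left_filter; exact: continuous_horner.
- by move=> s _; rewrite derivE.
Qed.

(** Bezout gives [a * 'X^N + b * ('X - 1) ^+ N = 1], so [e := b * ('X - 1) ^+ N] is 1 modulo ['X^N]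
    and 0 modulo [('X - 1) ^+ N]. The polynomial ['X^i * e], divided by [i!], then has the unit jet
    of index [i] at 0 and the zero jet at 1. *)
Lemma hermite_basis N (i : 'I_N) : exists h : {poly R}, forall j, (j < N)%N ->
  h^`(j).[0] = (j == i :> nat)%:R /\ h^`(j).[1] = 0.
Proof.
have : coprimep ('X^N : {poly R}) (('X - 1%:P) ^+ N).
  apply: coprimep_expl; apply: coprimep_expr.
  by rewrite coprimep_XsubC rootX oner_eq0.
move=> /Bezout_eq1_coprimepP[[a b] /= ab].
pose e := b * ('X - 1%:P) ^+ N.
have eE : e = 1 - a * 'X^N by rewrite /e -ab addrAC subrr add0r.
exists ((i`!%:R)^-1 *: ('X^i * e)) => j jN; split.
  rewrite derivn_at0 coefZ coefXnM.
  case: ltnP => ij; first by rewrite mulr0 mul0rn (ltn_eqF ij).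
  rewrite eE coefB coef1 coefMXn.
  have -> : (j - i < N)%N by rewrite (leq_ltn_trans _ jN) ?leq_subr.
  rewrite subr0 subn_eq0 [(j == i)%N]eqn_leq ij andbT.
  case: leqP => ji; last by rewrite mulr0 mul0rn.
  have -> : nat_of_ord i = j by apply/eqP; rewrite eqn_leq ij.
  by rewrite mulr1 -[LHS]mulr_natr mulVf// pnatr_eq0 -lt0n fact_gt0.
rewrite derivnZ hornerZ /e mulrA [_ * b * _]mulrC.
by rewrite derivn_multiple_root// mulr0.
Qed.

End PolyFacts.

(** * Trajectories as jets of polynomials *)

Section Jets.
Context {R : realType} {n : nat}.
Notation state := 'cV[R]_n.+1.
Notation mu := (@lebesgue_measure R).
Implicit Types (z : state) (P : {poly R}) (T t w : R).

(** The system is a chain of integrators: a trajectory consists of the successive derivatives of its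
    first coordinate, and the control is the derivative of order [n.+1]. *)
Definition jet P t : state := \col_(i < n.+1) P^`(i).[t].

Lemma velocity_jet P t i : velocity (jet P t) P^`(n.+1).[t] i = P^`(i.+1).[t].
Proof.
rewrite velocityE; case: ltnP => iN; first by rewrite mxE inordK.
have -> : i = ord_max by apply/val_inj/eqP; rewrite eqn_leq iN -ltnS ltn_ord.
by [].
Qed.

Lemma jet_solves P T : solves T (jet P 0) (fun s => P^`(n.+1).[s]) (jet P).
Proof.
move=> i; split.
  apply: (@eq_integrable _ _ _ mu _ _ (EFin \o horner P^`(i.+1))) => //.
    by move=> s _ /=; rewrite velocity_jet.
  apply: continuous_compact_integrable; first exact: segment_compact.
  apply: continuous_subspaceT => s; exact: continuous_horner.
move=> t /andP[t0 tT].
under eq_Rintegral do rewrite velocity_jet.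
by rewrite derivnS poly_integral// !mxE addrC subrK.
Qed.

Lemma null_control_jet z : exists (T : R) (P : {poly R}),
  [/\ 0 <= T, jet P 0 = z, jet P T = 0 &
      forall t, 0 <= t <= T -> -1 <= P^`(n.+1).[t] <= 1].
Proof.
(* Rescaling time by T >= 1 turns the initial datum z_i into T^i z_i and divides
   the control by T^(n+1), so the control is O(1/T). *)
have /choice[h hE] := @hermite_basis R n.+1.
have /choice[M ME] : forall i : 'I_n.+1, exists M : R,
    forall r, 0 <= r <= 1 -> `|(h i)^`(n.+1).[r]| <= M.
  move=> i; have [M MP] := poly_itv_bound (h i)^`(n.+1) 0 1.
  by exists M => r /andP[r0 r1]; apply: MP; rewrite r0.
have M0 i : 0 <= M i by apply: le_trans (ME i 0 _); rewrite ?lexx ?ler01.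
pose B := \sum_i `|z i 0| * M i.
have B0 : 0 <= B by apply: sumr_ge0 => i _; rewrite mulr_ge0.
pose T := 1 + B.
have T1 : 1 <= T by rewrite lerDl.
have T0 : 0 < T by rewrite (lt_le_trans ltr01).
pose P := \sum_i (z i 0 * T ^+ i) *: (h i \Po (T^-1 *: 'X + 0%:P)).
have PE j t : P^`(j).[t] =
    \sum_i z i 0 * T ^+ i * (T^-1 ^+ j * (h i)^`(j).[T^-1 * t]).
  rewrite /P (raddf_sum (derivn j)) horner_sum; apply: eq_bigr => i _.
  by rewrite /= derivnZ derivn_comp_affine !hornerE horner_comp !hornerE.
exists T, P; split.
- exact: ltW.
- apply/colP => j; rewrite mxE PE (bigD1 j)//= big1 ?addr0.
    rewrite mulr0; have [-> _] := hE j j (ltn_ord j).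
    by rewrite eqxx mulr1 exprVn mulfK// expf_neq0// gt_eqF.
  move=> i ij; rewrite mulr0; have [-> _] := hE i j (ltn_ord j).
  by rewrite val_eqE eq_sym (negbTE ij) !mulr0.
- apply/colP => j; rewrite !mxE PE big1// => i _.
  rewrite mulVf ?gt_eqF//; have [_ ->] := hE i j (ltn_ord j).
  by rewrite !mulr0.
move=> t /andP[t0 tT]; rewrite -ler_norml PE.
apply: (le_trans (ler_norm_sum _ _ _)).
apply: (@le_trans _ _ (\sum_i `|z i 0| * M i / T)).
  apply: ler_sum => i _.
  rewrite !normrM -!mulrA ler_wpM2l// [leRHS]mulrC mulrA.
  apply: ler_pM => //.
    rewrite !ger0_norm ?exprn_ge0 ?invr_ge0 ?(ltW T0)//.
    rewrite exprSr mulrA ler_piMl ?invr_ge0 ?(ltW T0)//.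
    rewrite exprVn ler_pdivrMr ?exprn_gt0// mul1r.
    by rewrite ler_weXn2l// -ltnS ltn_ord.
  apply: ME; rewrite mulr_ge0 ?invr_ge0 ?(ltW T0)//= mulrC.
  by rewrite ler_pdivrMr// mul1r.
by rewrite -mulr_suml ler_pdivrMr// mul1r /T lerDr ler01.
Qed.

(** The Taylor polynomial with derivatives [z] up to order [n] and [w] at order [n.+1] follows the
    flow of the constant control [w] through [z]. Being a polynomial, it also gives the flow at
    negative times, which [HJ_lower] uses. *)
Lemma flow_jet z w : exists P : {poly R},
  jet P 0 = z /\ forall t, P^`(n.+1).[t] = w.
Proof.
pose c j := (if (j <= n)%N then z (inord j) 0 else w) / j`!%:R.
pose P := \poly_(j < n.+2) c j.
have f0 j : j`!%:R != 0 :> R by rewrite pnatr_eq0 -lt0n fact_gt0.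
exists P; split.
  apply/colP => j; rewrite mxE derivn_at0 coef_poly (ltn_trans (ltn_ord j))//.
  by rewrite -mulr_natr /c -ltnS ltn_ord mulfVK// inord_val.
have -> : P^`(n.+1) = w%:P.
  apply/polyP => k; rewrite coef_derivn coefC coef_poly -[X in (_ < X)%N]addn1.
  rewrite ltn_add2l ltnS leqn0; case: eqP => [->|_]; last by rewrite mul0rn.
  by rewrite addn0 ffactnn -mulr_natr /c ltnn mulfVK.
by move=> t; rewrite hornerC.
Qed.

End Jets.

(** * Almost everywhere convergence of near-optimal controls *)

(** The infima of [N] over the decreasing sets [S k] increase to a finite limit, so beyond some
    index they vary by less than [e k]. Two near-minimizers taken beyond it have almost the same
    [N], and their midpoint, still in the set, cannot go below the infimum. *)
Lemma midpoint_minimizing_sequence (R : realType) (X : Type) (S : nat -> set X)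
    (N : X -> R) (mid : X -> X -> X) (e : nat -> R) :
  (forall k, S k !=set0) -> (forall k m, (k <= m)%N -> S m `<=` S k) ->
  (forall k a b, S k a -> S k b -> S k (mid a b)) ->
  (forall a, S 0%N a -> 0 <= N a <= 1) ->
  (forall k, 0 < e k) -> (forall k, e k.+1 <= e k) ->
  exists w : nat -> X, forall k, S k (w k) /\
    (N (w k) + N (w k.+1)) / 2 - N (mid (w k) (w k.+1)) <= 2 * e k.
Proof.
move=> S0 Sdec Smid N01 e0 edec.
pose m k := inf (N @` S k).
have hl k : has_lbound (N @` S k).
  by exists 0 => _ [a Sa <-]; case/andP: (N01 a (Sdec _ _ (leq0n k) _ Sa)).
have hi k : has_inf (N @` S k).
  by split => //; have [a Sa] := S0 k; exists (N a), a.
have mle k a : S k a -> m k <= N a.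
  by move=> Sa; apply: ge_inf => //; exists a.
have m1 k : m k <= 1.
  have [a Sa] := S0 k; apply: (le_trans (mle _ _ Sa)).
  by case/andP: (N01 a (Sdec _ _ (leq0n k) _ Sa)).
have mmono k l : (k <= l)%N -> m k <= m l.
  move=> kl; apply: lb_le_inf; first by have [a Sa] := S0 l; exists (N a), a.
  by move=> _ [a Sa <-]; apply: mle; exact: Sdec kl _ Sa.
have hs : has_sup (range m).
  split; first by exists (m 0%N), 0%N.
  by exists 1 => _ [k _ <-].
pose M := sup (range m).
have mM k : m k <= M by apply: ub_le_sup; [case: hs|exists k].
have /choice[f fP] : forall k, exists i, M - e k < m i.
  move=> k; have [_ [i _ <-] Mi] := sup_adherent (e0 k) hs.
  by exists i.
(* Cumulative sums make [g] nondecreasing while keeping it above both [k] and [f k]. *)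
pose g k := (k + \sum_(j < k.+1) f j)%N.
have gk k : (k <= g k)%N by exact: leq_addr.
have gf k : (f k <= g k)%N.
  by rewrite /g big_ord_recr /= addnA leq_addl.
have gS k : (g k <= g k.+1)%N.
  by rewrite /g [in leqRHS]big_ord_recr /= leq_add// leq_addr.
have /choice[w wP] : forall k, exists a, S (g k) a /\ N a < m (g k) + e k.
  move=> k; have [_ [a Sa <-] aN] := inf_adherent (e0 k) (hi (g k)).
  by exists a.
exists w => k; have [Sk wk] := wP k; have [Sk1 wk1] := wP k.+1.
split; first exact: Sdec (gk k) _ Sk.
(* Both points lie in the larger set [S (g k)], hence so does their midpoint. The inequalities that
   follow bound the gap by [3/2 * e k]. *)
have Smk := Smid _ _ _ Sk (Sdec _ _ (gS k) _ Sk1).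
have h1 := mle _ _ Smk; have h2 := mM (g k.+1).
have h3 := lt_le_trans (fP k) (mmono _ _ (gf k)).
have h4 := edec k; have h5 := e0 k.
lra.
Qed.

Lemma cvg_of_square_summable (R : realType) (d : nat -> R) (C : R) :
  (forall k, \sum_(j < k) 2 ^+ j * (d j.+1 - d j) ^+ 2 <= C) -> cvgn d.
Proof.
move=> dC.
have -> : d = (fun k => d 0%N + series (telescope d) k).
  by apply/funext => k; exact: eq_sum_telescope.
apply: is_cvgD; first exact: is_cvg_cst.
apply: normed_cvg; apply: nondecreasing_is_cvgn.
  by apply/nondecreasing_seqP => k; rewrite /= /series /= big_nat_recr//= lerDl.
(* [C] accounts for the weighted squares and 2 is the sum of the geometric series of ratio 1/2. *)
exists (C + 2) => _ [k _ <-]; rewrite /= /series /= big_mkord.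
apply: (@le_trans _ _ (\sum_(j < k) (2 ^+ j * (d j.+1 - d j) ^+ 2 + (1/2) ^+ j))).
  apply: ler_sum => j _; rewrite /telescope.
  set a := d j.+1 - d j; have -> : (1 / 2) ^+ j = (2 ^+ j)^-1 :> R.
    by rewrite div1r exprVn.
  (* AM-GM: |a| <= h a^2 + h^-1 with h = 2^j *)
  have h0 : 0 < 2 ^+ j :> R by rewrite exprn_gt0.
  set h := 2 ^+ j in h0 *.
  rewrite -(@ler_pM2l _ h)// mulrDr divff ?gt_eqF// -[a ^+ 2]real_normK ?num_real//.
  have := sqr_ge0 (h * `|a| - 1/2); have := normr_ge0 a; nra.
rewrite big_split /=; apply: lerD; first exact: dC.
have -> : \sum_(j < k) (1 / 2) ^+ j = series (geometric 1 (1 / 2)) k :> R.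
  by rewrite /series /= big_mkord; apply: eq_bigr => j _; rewrite [RHS]mul1r.
have h0 : 0 < 1 / 2 :> R by lra.
have h1 : `|1 / 2| < 1 :> R by rewrite ger0_norm; lra.
apply: (le_trans (geometric_le_lim k ler01 h0 h1)).
by rewrite (_ : 1 - 1 / 2 = 2^-1) ?invrK ?mul1r//; lra.
Qed.

(** * Weighted L^2 norms of controls *)

Section WeightedL2.
Context {R : realType}.
Notation mu := (@lebesgue_measure R).
Variable W : R -> R.
Hypothesis mW : measurable_fun [set: R] W.
Hypothesis W0 : forall t, 0 <= W t.
Hypothesis iW : mu.-integrable setT (EFin \o W).
Hypothesis W1 : \int[mu]_t W t = 1.
Implicit Types u v : R -> R.

Lemma weighted_bounded_integrable (h : R -> R) (C : R) : measurable_fun [set: R] h ->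
  (forall t, `|h t| <= C) -> mu.-integrable setT (EFin \o (fun t => W t * h t)).
Proof.
move=> mh hC.
have iCW : mu.-integrable setT (fun t => C%:E * (EFin \o W) t)%E.
  exact: integrableZl.
apply: le_integrable iCW => //.
  by apply/measurable_EFinP; exact: measurable_funM.
move=> t _; rewrite /= lee_fin !normrM mulrC.
by rewrite ler_wpM2r// (le_trans (hC t))// ler_norm.
Qed.

(** The squared norm of L^2 for the probability density [W]: a weight of mass 1 makes bounded
    controls square integrable over an infinite horizon, with norm at most 1. *)
Definition wnorm2 u := \int[mu]_t (W t * u t ^+ 2).

Lemma wnorm2_integrable u C : measurable_fun [set: R] u -> (forall t, `|u t| <= C) ->
  mu.-integrable setT (EFin \o (fun t => W t * u t ^+ 2)).
Proof.
move=> mu_u uC; apply: (@weighted_bounded_integrable _ (C ^+ 2)).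
  exact: measurable_funX.
by move=> t; rewrite normrX lerXn2r// ?nnegrE ?normr_ge0// (le_trans _ (uC t)).
Qed.

Lemma wnorm2_ge0 u : 0 <= wnorm2 u.
Proof. by apply: Rintegral_ge0 => t _; rewrite mulr_ge0// sqr_ge0. Qed.

Lemma wnorm2_le1 u : good_control u -> wnorm2 u <= 1.
Proof.
move=> [mu_u u1]; have ub t : `|u t| <= 1 by rewrite ler_norml u1.
rewrite -W1; apply: le_Rintegral => //; first exact: wnorm2_integrable ub.
move=> t _; rewrite ler_piMr// -[_ ^+ 2]real_normK ?num_real//.
by rewrite expr_le1.
Qed.

(** Quantitative strict convexity: a small midpoint gap, as supplied by
    [midpoint_minimizing_sequence], forces [u] and [v] to be close in weighted norm. *)
Lemma parallelogram u v : good_control u -> good_control v ->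
  4^-1 * wnorm2 (fun t => v t - u t) =
  (wnorm2 u + wnorm2 v) / 2 - wnorm2 (fun t => 1/2 * u t + 1/2 * v t).
Proof.
move=> [mu_u u1] [mv v1].
have ub t : `|u t| <= 1 by rewrite ler_norml u1.
have vb t : `|v t| <= 1 by rewrite ler_norml v1.
have iu := wnorm2_integrable mu_u ub; have iv := wnorm2_integrable mv vb.
have ib : mu.-integrable setT (EFin \o (fun t => W t * (v t - u t) ^+ 2)).
  apply: (@wnorm2_integrable _ 2); first exact: measurable_funB.
  by move=> t; apply: (le_trans (ler_normB _ _)); rewrite (_ : 2 = 1 + 1)// lerD.
have im : mu.-integrable setT (EFin \o (fun t => W t * (1/2 * u t + 1/2 * v t) ^+ 2)).
  apply: (@wnorm2_integrable _ 1).
    by apply: measurable_funD; apply: measurable_funM.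
  move=> t; move: (ub t) (vb t); rewrite !ler_norml => /andP[? ?] /andP[? ?].
  by apply/andP; split; lra.
have Z (k : R) (h : R -> R) : mu.-integrable setT (EFin \o h) ->
    mu.-integrable setT (EFin \o (fun t => k * h t)).
  move=> hi; have : mu.-integrable setT (fun x => k%:E * (EFin \o h) x)%E.
    exact: integrableZl.
  by apply: eq_integrable => // x _ /=; rewrite EFinM.
have : \int[mu]_t (4^-1 * (W t * (v t - u t) ^+ 2) +
     1 * (W t * (1/2 * u t + 1/2 * v t) ^+ 2)) =
    \int[mu]_t (1/2 * (W t * u t ^+ 2) + 1/2 * (W t * v t ^+ 2)).
  by apply: eq_Rintegral => t _; field.
rewrite (RintegralD _ (Z _ _ ib) (Z _ _ im))// (RintegralD _ (Z _ _ iu) (Z _ _ iv))//.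
rewrite !RintegralZl// /wnorm2; lra.
Qed.

(** The decay [(1/4) ^+ k] beats the weight [2 ^+ k], so the series of
    [2 ^+ k * W t * (u k.+1 t - u k t) ^+ 2] has a finite integral and hence a finite sum for almost
    every [t]. Where [0 < W t], this is the hypothesis of [cvg_of_square_summable]. *)
Lemma ae_cvg_of_wnorm2 (u : nat -> R -> R) : (forall k, good_control (u k)) ->
  (forall k, wnorm2 (fun t => u k.+1 t - u k t) <= 8 * (1/4) ^+ k) ->
  {ae mu, forall t, 0 < W t -> cvgn (fun k => u k t)}.
Proof.
move=> ug uk.
pose f k t := (2 ^+ k * (W t * (u k.+1 t - u k t) ^+ 2))%:E.
have f0 k t : (0 <= f k t)%E.
  by rewrite lee_fin mulr_ge0 ?exprn_ge0// mulr_ge0// sqr_ge0.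
have mf k : measurable_fun setT (f k).
  apply/measurable_EFinP; apply: measurable_funM => //; apply: measurable_funM => //.
  apply: measurable_funX; apply: measurable_funB.
    by case: (ug k.+1).
  by case: (ug k).
(* The bound is [8 / 2 ^ k], written in the shape of the geometric series lemma that sums it. *)
have fi k : (\int[mu]_t f k t <= (16 / (2 ^ (k + 1))%:R)%:E)%E.
  have di : mu.-integrable setT (EFin \o (fun t => W t * (u k.+1 t - u k t) ^+ 2)).
    apply: (@wnorm2_integrable _ 2).
      by apply: measurable_funB; [case: (ug k.+1)|case: (ug k)].
    move=> t; have [_ /(_ t)] := ug k; have [_ /(_ t)] := ug k.+1.
    by rewrite ler_norml => /andP[? ?] /andP[? ?]; apply/andP; split; lra.
  rewrite /f; under eq_integral do rewrite EFinM.
  rewrite integralZl// -(fineK (integrable_fin_num _ di))//.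
  rewrite -[fine _]/(wnorm2 _) -EFinM lee_fin.
  apply: (@le_trans _ _ (2 ^+ k * (8 * (1 / 4) ^+ k))).
    by rewrite ler_wpM2l ?exprn_ge0.
  rewrite natrX addn1 exprS mulrCA -exprMn.
  rewrite (_ : 2 * (1 / 4) = 2^-1 :> R); last by field.
  rewrite exprVn invfM; set z := (2 ^+ k)^-1.
  by rewrite mulrA (_ : 16 / 2 = 8 :> R)//; field.
pose G t := (\sum_(k <oo) f k t)%E.
have G0 t : (0 <= G t)%E by exact: nneseries_ge0.
have mG : measurable_fun setT G by exact: ge0_emeasurable_sum.
have Gi : mu.-integrable setT G.
  apply/integrableP; split => //.
  under eq_integral do rewrite gee0_abs//.
  rewrite integral_nneseries//.
  apply: (@le_lt_trans _ _ (\sum_(k <oo) (16 / (2 ^ (k + 1))%:R)%:E)%E).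
    by apply: lee_nneseries => // k _ _; exact: integral_ge0.
  have /cvg_lim := @cvg_geometric_eseries_half R 16 0.
  by rewrite /eseries /= => ->//; rewrite ltry.
have := integrable_ae (@measurableT _ _) Gi.
apply: ae_imply => t /(_ I) Gt Wt.
apply: (@cvg_of_square_summable _ _ (fine (G t) / W t)) => k.
rewrite ler_pdivlMr// -lee_fin fineK//.
have := @nneseries_lim_ge R (f ^~ t) xpredT 0 k (fun n _ _ => f0 n t).
apply: le_trans; rewrite big_mkord sumEFin lee_fin mulr_suml.
by apply: ler_sum => j _; rewrite mulrAC -mulrA.
Qed.

End WeightedL2.

(** * Existence of optimal controls *)

Section Limits.
Context {R : realType}.
Notation mu := (@lebesgue_measure R).

(** An upper limit is measurable whether or not the sequence converges, and clamping puts it in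
    [-1, 1] at every time; where the sequence converges, both operations return the limit. *)
Lemma good_control_limit (u : nat -> R -> R) (W : R -> R) :
  (forall k, good_control (u k)) ->
  {ae mu, forall t, 0 < W t -> cvgn (fun k => u k t)} ->
  exists v, good_control v /\
    {ae mu, forall t, 0 < W t -> u k t @[k --> \oo] --> v t}.
Proof.
move=> ug uc.
pose v t := Num.max (-1) (Num.min 1 (limn_sup (fun k => u k t))).
have ub t : has_ubound (range (fun k => u k t)).
  by exists 1 => _ [k _ <-]; have [_ /(_ t)/andP[]] := ug k.
have lb t : has_lbound (range (fun k => u k t)).
  by exists (-1) => _ [k _ <-]; have [_ /(_ t)/andP[]] := ug k.
exists v; split.
  split.
    apply: measurable_maxr => //; apply: measurable_minr => //.
    by apply: measurable_fun_limn_sup => // k; case: (ug k).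
  by move=> t; rewrite /v le_max lexx ge_max /= ge_min lexx andbT; lra.
apply: ae_imply uc => t ut Wt; have {}ut := ut Wt.
rewrite /v (cvg_limn_supE ut) min_r ?max_r//.
  by apply: limr_ge => //; apply: nearW => k; have [_ /(_ t)/andP[]] := ug k.
by apply: limr_le => //; apply: nearW => k; have [_ /(_ t)/andP[]] := ug k.
Qed.

(** Dominated convergence with the constant [B]. The last conclusion, uniform in [k], serves as the
    domination for the next coordinate of the chain. *)
Lemma cvg_primitive T c (f g : nat -> R -> R) (h : R -> R) (B : R) :
  (forall k, primitive T c (f k) (g k)) ->
  (forall k t, 0 <= t <= T -> `|f k t| <= B) ->
  {ae mu, forall t, 0 <= t <= T -> f k t @[k --> \oo] --> h t} ->
  measurable_fun (`[0, T] : set R) h ->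
  [/\ mu.-integrable `[0, T] (EFin \o h),
   forall t, 0 <= t <= T -> g k t @[k --> \oo] --> c + \int[mu]_(s in `[0, t]) h s &
   forall k t, 0 <= t <= T -> `|g k t| <= `|c| + B * T].
Proof.
move=> pr fB fh mh.
have dom t : 0 <= t <= T -> mu.-integrable `[0, t] (EFin \o h) /\
    \int[mu]_(s in `[0, t]) f k s @[k --> \oo] --> \int[mu]_(s in `[0, t]) h s.
  move=> /andP[t0 tT].
  have fi k : mu.-integrable `[0, t] (EFin \o f k).
    have [fi _] := pr k; apply: integrableS fi => //; exact: subset_itv0.
  have [] := @dominated_convergence _ (measurableTypeR R) R mu `[0, t]%classic _
    (fun k => EFin \o f k) (EFin \o h) (cst B%:E) _ _ _ _ _ => //.
  - by move=> k; case/integrableP: (fi k).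
  - apply/measurable_EFinP; apply: measurable_funS mh => //; exact: subset_itv0.
  - apply: ae_imply fh => s fs /=; rewrite in_itv/= => /andP[s0 st].
    apply: cvg_EFin; first exact: nearW.
    by apply: fs; rewrite s0 (le_trans st).
  - apply: measurable_bounded_integrable => //=.
      by rewrite lebesgue_measure_itv/=; case: ifP => // _; rewrite -EFinB ltry.
    exact: bounded_cst.
  - apply: aeW => s k /=; rewrite in_itv/= => /andP[s0 st].
    by rewrite lee_fin fB// s0 (le_trans st).
  move=> hi _ hc; split => //.
  apply: fine_cvg.
  rewrite fineK//; exact: integrable_fin_num.
have [T0|T0] := leP 0 T; last first.
  split.
  - by rewrite set_itv_ge ?bnd_simp -?ltNge//; exact: integrable_set0.
  - by move=> t /andP[t0 tT]; have := le_lt_trans (le_trans t0 tT) T0; rewrite ltxx.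
  - by move=> k t /andP[t0 tT]; have := le_lt_trans (le_trans t0 tT) T0; rewrite ltxx.
have B0 : 0 <= B.
  by apply: (le_trans _ (fB 0%N 0 _)); rewrite ?lexx.
split.
- by case: (dom T); rewrite ?T0 ?lexx.
- move=> t tT; have [_ /= gc] := dom t tT.
  have -> : (fun k => g k t) = (fun k => c + \int[mu]_(s in `[0, t]) f k s).
    by apply/funext => k; have [_ ->] := pr k.
  by apply: cvgD => //; exact: cvg_cst.
move=> k t /andP[t0 tT]; have [fi ->] := pr k; last by rewrite t0.
apply: (le_trans (ler_normD _ _)); rewrite lerD2l.
have fit : mu.-integrable `[0, t] (EFin \o f k).
  by apply: integrableS fi => //; exact: subset_itv0.
apply: (le_trans (le_normr_Rintegral _ fit)) => //.
have ci : mu.-integrable `[0, t] (EFin \o cst B).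
  apply: measurable_bounded_integrable => //=.
    by rewrite lebesgue_measure_itv/=; case: ifP => // _; rewrite -EFinB ltry.
  exact: bounded_cst.
apply: (@le_trans _ _ (\int[mu]_(s in `[0, t]) B)).
  apply: le_Rintegral => //; first exact: integrable_norm.
  move=> s /=; rewrite in_itv/= => /andP[s0 st]; apply: fB.
  by rewrite s0 (le_trans st).
rewrite Rintegral_cst//= lebesgue_measure_itv/= lte_fin.
case: ltP => _ /=; last by rewrite mulr0 mulr_ge0// B0.
by rewrite subr0 ler_wpM2l.
Qed.

End Limits.

(** * Passing to the limit in the control system *)

Section TrajectoryLimits.
Context {R : realType} {n : nat}.
Notation state := 'cV[R]_n.+1.
Notation mu := (@lebesgue_measure R).

(** Induction on [n - i], starting from the last coordinate: its velocity is the control, which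
    converges almost everywhere with bound 1, and each other coordinate has the following one as
    velocity. The predicate [good] carries the bound and the convergence that the next application
    of [cvg_primitive] requires. *)
Lemma solves_limit (p : state) (u : nat -> R -> R) (x : nat -> R -> state) v :
  (forall k, good_control (u k)) -> good_control v ->
  (forall k T, 0 <= T -> solves T p (u k) (x k)) ->
  {ae mu, forall t, 0 <= t -> u k t @[k --> \oo] --> v t} ->
  exists y, (forall T, 0 <= T -> solves T p v y) /\
    forall t, 0 <= t -> x k t @[k --> \oo] --> y t.
Proof.
move=> ug vg sx uv.
pose y t : state := \col_i limn (fun k => x k t i 0).
pose good i := [/\ (forall T, 0 <= T -> exists B, forall k t, 0 <= t <= T ->
       `|x k t i 0| <= B),
     (forall t, 0 <= t -> x k t i 0 @[k --> \oo] --> y t i 0) &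
     (forall T, 0 <= T -> primitive T (p i 0) (fun s => velocity (y s) (v s) i)
        (fun s => y s i 0))].
have step i : (forall T, 0 <= T -> exists B, forall k t, 0 <= t <= T ->
        `|velocity (x k t) (u k t) i| <= B) ->
      {ae mu, forall t, 0 <= t ->
        velocity (x k t) (u k t) i @[k --> \oo] --> velocity (y t) (v t) i} ->
      (forall T, measurable_fun (`[0, T] : set R) (fun t => velocity (y t) (v t) i)) ->
    good i.
  move=> Bv cv mv.
  have H T : 0 <= T -> exists B,
    [/\ mu.-integrable `[0, T] (EFin \o (fun s => velocity (y s) (v s) i)),
     forall t, 0 <= t <= T -> x k t i 0 @[k --> \oo] -->
        p i 0 + \int[mu]_(s in `[0, t]) velocity (y s) (v s) i &
     forall k t, 0 <= t <= T -> `|x k t i 0| <= B].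
    move=> T0; have [B BP] := Bv T T0; exists (`|p i 0| + B * T).
    apply: (@cvg_primitive R T (p i 0) (fun k t => velocity (x k t) (u k t) i)
      (fun k t => x k t i 0)) => //.
      by move=> k; exact: sx.
    by apply: ae_imply cv => t vt /andP[t0 _]; exact: vt.
  have yE t : 0 <= t ->
      y t i 0 = p i 0 + \int[mu]_(s in `[0, t]) velocity (y s) (v s) i.
    move=> t0; have [B [_ /(_ t) + _]] := H t t0; rewrite t0 lexx => /(_ isT).
    by move=> /cvg_lim <-//; rewrite mxE.
  split.
  - by move=> T T0; have [B [_ _ BP]] := H T T0; exists B.
  - move=> t t0; have [B [_ /(_ t) + _]] := H t t0; rewrite t0 lexx => /(_ isT).
    by rewrite yE.
  - move=> T T0; have [B [yi _ _]] := H T T0; split => // t /andP[t0 _].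
    exact: yE.
have main : forall d (i : 'I_n.+1), (n - i = d)%N -> good i.
  elim=> [|d IH] i di.
    have iN : (n <= i)%N by rewrite -subn_eq0 di.
    have vE z w : velocity z w i = w by rewrite velocityE ltnNge iN.
    apply: step.
    - by move=> T T0; exists 1 => k t _; rewrite vE ler_norml; case: (ug k).
    - apply: ae_imply uv => t ut t0; rewrite vE.
      rewrite (_ : (fun k => _) = (fun k => u k t)); first exact: ut.
      by apply/funext => k; rewrite vE.
    - move=> T; rewrite (_ : (fun t => _) = v); last by apply/funext => t; rewrite vE.
      by apply: measurable_funTS; case: vg.
  have iN : (i < n)%N by rewrite -subn_gt0 di.
  have vE z w : velocity z w i = z (inord i.+1) 0 by rewrite velocityE iN.
  have [|Bx cx py] := IH (inord i.+1); first by rewrite inordK// subnS di.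
  apply: step.
  - by move=> T T0; have [B BP] := Bx T T0; exists B => k t tT; rewrite vE BP.
  - apply: aeW => t t0; rewrite vE.
    rewrite (_ : (fun k => _) = (fun k => x k t (inord i.+1) 0)); first exact: cx.
    by apply/funext => k; rewrite vE.
  - move=> T; rewrite (_ : (fun t => _) = (fun t => y t (inord i.+1) 0)); last first.
      by apply/funext => t; rewrite vE.
    have [T0|T0] := leP 0 T; last first.
      by rewrite set_itv_ge ?bnd_simp -?ltNge//; exact: measurable_fun_set0.
    apply: subspace_continuous_measurable_fun => //.
    exact: primitive_continuous T0 (py T T0).
exists y; split.
  by move=> T T0 i; have [_ _ /(_ T T0)] := main _ i erefl.
by move=> t t0; apply: cvg_col => i; have [_ /(_ t t0)] := main _ i erefl.
Qed.

End TrajectoryLimits.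

(** * Finiteness of the value and optimal controls *)

Section Existence.
Context {R : realType} {n : nat}.
Notation state := 'cV[R]_n.+1.
Notation mu := (@lebesgue_measure R).
Variable F : state -> R.
Hypothesis Fcont : continuous F.
Hypothesis F0 : F 0 = 0.
Hypothesis Fge0 : forall z, 0 <= F z.
Hypothesis Fconv : forall (a b : R) (z w : state), 0 <= a -> 0 <= b -> a + b = 1 ->
  F (a *: z + b *: w) <= a * F z + b * F w.
Implicit Types (p q : state) (u v : R -> R) (x y : R -> state).

Lemma value_lty p : (value F p < +oo)%E.
Proof.
have [T [P [T0 P0 PT P1]]] := null_control_jet p.
have sP := jet_solves (n := n) P T; rewrite P0 in sP.
have mP : measurable_fun (`[0, T] : set R) (fun s => P^`(n.+1).[s]).
  apply: measurable_funTS; apply: continuous_measurable_fun.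
  exact: continuous_horner.
apply: (le_lt_trans (dynamic_programming Fcont Fge0 T0 mP P1 sP)).
rewrite PT lte_add_pinfty ?ltry//.
(* Once the origin is reached, the zero control stays there at no cost. *)
have ad : admissible (0 : state) (fun=> 0) (fun=> 0).
  apply: solves_admissible.
    by split=> // t; rewrite lerN10 ler01.
  move=> T' T'0 i; split.
    apply: (@eq_integrable _ _ _ mu _ _ (cst 0%E)); [by []| |exact: integrable0].
    move=> s _ /=; rewrite velocityE; case: ifP => //; first by rewrite mxE.
  move=> t _; rewrite mxE add0r; apply/esym.
  under eq_Rintegral.
    move=> s _; rewrite (_ : velocity _ _ _ = 0); last first.
      by rewrite velocityE; case: ifP => //; rewrite mxE.
    over.
  by rewrite Rintegral_cst// mul0r.
apply: (le_lt_trans (value_le_cost F ad)).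
rewrite /cost integral0_eq ?ltry// => t _.
by rewrite F0.
Qed.

Lemma value_fin p : value F p \is a fin_num.
Proof. by rewrite ge0_fin_numE ?value_lty// value_ge0. Qed.

Lemma cost_convex (a b : R) x y : 0 <= a -> 0 <= b -> a + b = 1 ->
  {within `[0, +oo[, continuous x} -> {within `[0, +oo[, continuous y} ->
  {within `[0, +oo[, continuous (fun t => a *: x t + b *: y t)} ->
  (cost F (fun t => (a *: x t + b *: y t)%R) <=
   a%:E * cost F x + b%:E * cost F y)%E.
Proof.
move=> a0 b0 ab xc yc zc.
have m (z : R -> state) : {within `[0, +oo[, continuous z} ->
    measurable_fun (`[0, +oo[ : set R) (EFin \o (F \o z)).
  by move=> zc'; apply/measurable_EFinP; exact: (running_cost_measurable Fcont zc').
have mZ (c : R) (z : R -> state) : {within `[0, +oo[, continuous z} ->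
    measurable_fun (`[0, +oo[ : set R) (fun t => (c%:E * (F (z t))%:E)%E).
  move=> zc'; apply/measurable_EFinP; apply: measurable_funM => //.
  exact: (running_cost_measurable Fcont zc').
rewrite /cost -!ge0_integralZl_EFin//; try exact: m; try by move=> t _; rewrite lee_fin.
rewrite -ge0_integralD//; try exact: mZ;
  try by move=> t _; rewrite -EFinM lee_fin mulr_ge0.
apply: ge0_le_integral => //.
- by move=> t _; rewrite lee_fin.
- exact: m.
- by apply: emeasurable_funD; exact: mZ.
- by move=> t _; rewrite -!EFinM -EFinD lee_fin; exact: Fconv.
Qed.

Lemma exists_optimal p : exists u x, good_control u /\
  (forall T, 0 <= T -> solves T p u x) /\ optimal F p u x.
Proof.
(* With ratio 1/4, the midpoint gap [2 * e k], multiplied by 4 in the parallelogram identity, is the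
   rate [8 * (1/4) ^+ k] of [ae_cvg_of_wnorm2]. *)
pose e k : R := (1 / 4) ^+ k.
have e0 k : 0 < e k by rewrite exprn_gt0//; lra.
have edec k : e k.+1 <= e k by rewrite /e exprS ler_piMl ?exprn_ge0//; lra.
have emono k m : (k <= m)%N -> e m <= e k.
  by move=> km; apply: ler_wiXn2l => //; lra.
pose S k : set ((R -> R) * (R -> state)) := [set ux | good_control ux.1 /\
  (forall T, 0 <= T -> solves T p ux.1 ux.2) /\
  (cost F ux.2 <= value F p + (e k)%:E)%E].
pose mid (a b : (R -> R) * (R -> state)) : (R -> R) * (R -> state) :=
  (fun t => 1/2 * a.1 t + 1/2 * b.1 t, fun t => (1/2) *: a.2 t + (1/2) *: b.2 t).
(* A probability density positive at every nonnegative time, so that convergence where [0 < W t]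
   covers the whole half-line. *)
pose W := exponential_pdf (1 : R).
have mW : measurable_fun [set: R] W by exact: measurable_exponential_pdf.
have W0 t : 0 <= W t by apply: exponential_pdf_ge0; exact: ler01.
have iW : mu.-integrable setT (EFin \o W) by exact: integrable_exponential_pdf.
have W1 : \int[mu]_t W t = 1 by rewrite /Rintegral integral_exponential_pdf.
have Wpos t : 0 <= t -> 0 < W t.
  by move=> t0; rewrite /W exponential_pdfE// /exponential_pdf mul1r expR_gt0.
have [w wP] : exists w : nat -> (R -> R) * (R -> state), forall k, S k (w k) /\
    (wnorm2 W (w k).1 + wnorm2 W (w k.+1).1) / 2
      - wnorm2 W (mid (w k) (w k.+1)).1 <= 2 * e k.
  apply: (@midpoint_minimizing_sequence R _ S (fun a => wnorm2 W a.1)) => //.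
  - move=> k; have := lb_ereal_inf_adherent (e0 k) (value_fin p).
    move=> [_ [u [x [ad ->]]] /ltW cx].
    have [v [vg [sx _]]] := admissible_good ad.
    by exists (v, x).
  - move=> k m km [u x] /= [ug [sx cx]]; split => //; split => //.
    by apply: (le_trans cx); rewrite leeD2l// lee_fin emono.
  - move=> k [u x] [v y] [/= ug [sx cx]] [/= vg [sy cy]].
    have sm T : 0 <= T -> solves T p (fun t => 1/2 * u t + 1/2 * v t)
        (fun t => (1/2) *: x t + (1/2) *: y t).
      move=> T0; have := solves_comb (1/2) (1/2) (sx T T0) (sy T T0).
      by rewrite -scalerDl (_ : 1/2 + 1/2 = 1 :> R) ?scale1r//; lra.
    split => /=.
      case: ug vg => mu_u u1 [mv v1]; split.
        by apply: measurable_funD; exact: measurable_funM.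
      move=> t; have /andP[? ?] := u1 t; have /andP[? ?] := v1 t.
      by apply/andP; split; lra.
    have h0 : 0 <= 1/2 :> R by lra.
    have h1 : 1/2 + 1/2 = 1 :> R by lra.
    split => //; apply: (le_trans (cost_convex h0 h0 h1 _ _ _)).
    + exact: solves_continuous sx.
    + exact: solves_continuous sy.
    + exact: solves_continuous sm.
    rewrite -(fineK (value_fin p)) in cx cy *.
    apply: (@le_trans _ _ ((1/2)%:E * ((fine (value F p))%:E + (e k)%:E) +
       (1/2)%:E * ((fine (value F p))%:E + (e k)%:E))%E).
      by apply: leeD; apply: lee_wpmul2l => //; rewrite lee_fin; lra.
    set V := fine _; rewrite -[leLHS]/((1/2 * (V + e k) + 1/2 * (V + e k))%:E).
    rewrite -[leRHS]/((V + e k)%:E) lee_fin; lra.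
  - by move=> [u x] [/= ug _]; rewrite wnorm2_ge0// wnorm2_le1.
have wg k : good_control (w k).1 by have [[]] := wP k.
have ws k T : 0 <= T -> solves T p (w k).1 (w k).2.
  by have [[_ []]] := wP k => + _ _; apply.
have wc k : (cost F (w k).2 <= value F p + (e k)%:E)%E by have [[_ []]] := wP k.
have := @ae_cvg_of_wnorm2 R W mW W0 iW (fun k => (w k).1) wg.
have wn k : wnorm2 W (fun t => (w k.+1).1 t - (w k).1 t) <= 8 * (1 / 4) ^+ k.
  have [_] := wP k; rewrite -(parallelogram mW iW (wg k) (wg k.+1)) /e.
  lra.
move=> /(_ wn) /(good_control_limit wg)[v [vg wv]].
have {}wv : {ae mu, forall t, 0 <= t -> (w k).1 t @[k --> \oo] --> v t}.
  by apply: ae_imply wv => t wt t0; exact: wt (Wpos t t0).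
have [y [sy wy]] := solves_limit wg vg ws wv.
exists v, y; split => //; split => //.
have ad := solves_admissible vg sy; split => //.
apply/eqP; rewrite eq_le (value_le_cost F ad) andbT.
have wF t : 0 <= t -> (F ((w k).2 t))%:E @[k --> \oo] --> (F (y t))%:E.
  move=> t0; apply: cvg_EFin; first exact: nearW.
  exact: (continuous_cvg _ (@Fcont (y t)) (wy t t0)).
(* Since [F] is continuous and the states converge at every time, Fatou's lemma bounds [cost F y] by
   the lower limit of the near-optimal costs. *)
have fat := @fatou _ (measurableTypeR R) R mu `[0, +oo[%classic _
  (fun k t => (F ((w k).2 t))%:E) _ _.
have -> : cost F y =
    (\int[mu]_(t in `[0%R, +oo[) limn_einf (fun k => (F ((w k).2 t))%:E))%E.
  apply: eq_integral => t /set_mem /=; rewrite in_itv/= andbT => t0.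
  rewrite is_cvg_limn_einfE; last by apply/cvg_ex; exists (F (y t))%:E; exact: wF.
  by apply/esym/cvg_lim => //; exact: wF.
apply: (le_trans (fat _ _ _)) => //.
- move=> k; apply/measurable_EFinP; apply: (running_cost_measurable Fcont).
  by apply: solves_continuous => T; exact: ws.
- by move=> k t _; rewrite lee_fin.
(* The lower limit is the limit of the infima over tails, and every tail contains an index [m] with
   [e m < eps]. *)
rewrite limn_einf_lim; apply: lime_le; first exact: is_cvg_einfs.
apply: nearW => k; apply/lee_addgt0Pr => eps eps0.
have [m km em] : exists2 m, (k <= m)%N & e m < eps.
  have := @cvg_geometric R 1 (1 / 4); rewrite ger0_norm; last lra.
  move=> /(_ ltac:(lra))/cvgrPdist_lt /(_ _ eps0) [M _ ME].
  exists (maxn k M); first exact: leq_maxl.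
  have ge : geometric 1 (1 / 4) (maxn k M) = e (maxn k M) by rewrite /= [LHS]mul1r.
  have : `|0 - geometric 1 (1 / 4) (maxn k M)| < eps by apply: ME; exact: leq_maxr.
  rewrite ge.
  by rewrite sub0r normrN ger0_norm// ltW.
apply: (@le_trans _ _ (value F p + (e m)%:E)%E).
  apply: le_trans (wc m); apply: ereal_inf_lbound; exists m => //.
by apply: leeD2l; rewrite lee_fin ltW.
Qed.

End Existence.

(** * Subgradients of finite convex functions *)

Section Subgradients.
Context {R : realType} {n : nat}.
Notation state := 'cV[R]_n.+1.
Implicit Types (l y z : state) (g : state -> R).

Lemma dot_comb l a b y z : dot l (a *: y + b *: z) = a * dot l y + b * dot l z.
Proof.
rewrite /dot !mulr_sumr -big_split /=; apply: eq_bigr => i _.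
by rewrite !mxE; ring.
Qed.

Lemma dotZ l a y : dot l (a *: y) = a * dot l y.
Proof. by have := dot_comb l a 0 y 0; rewrite scale0r mul0r !addr0. Qed.

Lemma dotB l y z : dot l (y - z) = dot l y - dot l z.
Proof. by have := dot_comb l 1 (-1) y z; rewrite scale1r scaleN1r mul1r mulN1r. Qed.

Lemma dotD l y z : dot l (y + z) = dot l y + dot l z.
Proof. by have := dot_comb l 1 1 y z; rewrite !scale1r !mul1r. Qed.

Lemma dot_delta l i : dot l (delta_mx i 0) = l i 0.
Proof.
rewrite /dot (bigD1 i)//= big1 ?addr0 => [|j ji]; first by rewrite mxE !eqxx mulr1.
by rewrite mxE (negbTE ji) mulr0.
Qed.

(* Finite-dimensional Hahn-Banach: the minorant is extended one coordinate at a
   time. *)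
Lemma linear_minorant g : g 0 = 0 ->
  (forall a b y z, 0 <= a -> 0 <= b -> a + b = 1 ->
    g (a *: y + b *: z) <= a * g y + b * g z) ->
  exists l, forall y, dot l y <= g y.
Proof.
move=> g0 gconv.
suff : forall k, (k <= n.+1)%N -> exists l, forall y,
    (forall i : 'I_n.+1, (k <= i)%N -> y i 0 = 0) -> dot l y <= g y.
  move=> /(_ n.+1 (leqnn _)) [l lP]; exists l => y; apply: lP => i.
  by rewrite leqNgt ltn_ord.
elim=> [_|k IH kn].
  exists 0 => y y0; have -> : y = 0 by apply/colP => i; rewrite mxE y0.
  by rewrite g0 /dot big1// => i _; rewrite !mxE mul0r.
have [l lP] := IH (ltnW kn).
pose ik : 'I_n.+1 := Ordinal kn; pose e : state := delta_mx ik 0.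
pose supp y := forall i : 'I_n.+1, (k <= i)%N -> y i 0 = 0.
have suppC a b y z : supp y -> supp z -> supp (a *: y + b *: z).
  by move=> sy sz i ki; rewrite !mxE sy// sz// !mulr0 addr0.
(* The value of the extended form on [e] must lie above all slopes in direction [- e] and below all
   slopes in direction [e]. The weights [s / (s + r)] and [r / (s + r)] are those that cancel [e] in
   the convex combination; [c] is then the supremum of the slopes of the first kind. *)
have key y z r s : supp y -> supp z -> 0 < r -> 0 < s ->
    (dot l z - g (z - r *: e)) / r <= (g (y + s *: e) - dot l y) / s.
  move=> sy sz r0 s0; have rs0 : 0 < s + r by rewrite addr_gt0.
  rewrite ler_pdivrMr// mulrAC ler_pdivlMr//.
  have sr1 : s / (s + r) + r / (s + r) = 1 by rewrite -mulrDl divff ?gt_eqF.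
  have := gconv _ _ (z - r *: e) (y + s *: e) (divr_ge0 (ltW s0) (ltW rs0))
    (divr_ge0 (ltW r0) (ltW rs0)) sr1.
  have -> : (s / (s + r)) *: (z - r *: e) + (r / (s + r)) *: (y + s *: e) =
      (s / (s + r)) *: z + (r / (s + r)) *: y.
    by apply/colP => i; rewrite !mxE; ring.
  have := lP _ (suppC (s / (s + r)) (r / (s + r)) z y sz sy).
  rewrite dot_comb => h1 h2; have := le_trans h1 h2.
  have M X Y : (s + r) * (s / (s + r) * X + r / (s + r) * Y) = s * X + r * Y.
    by field; rewrite gt_eqF.
  rewrite -(ler_pM2l rs0) !M; lra.
pose A := [set a | exists z r, [/\ supp z, 0 < r & a = (dot l z - g (z - r *: e)) / r]].
have supp0 : supp 0 by move=> i _; rewrite mxE.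
have A0 : A !=set0 by exists ((dot l 0 - g (0 - 1 *: e)) / 1), 0, 1.
have Aub y s : supp y -> 0 < s -> ubound A ((g (y + s *: e) - dot l y) / s).
  by move=> sy s0 _ [z [r [sz r0 ->]]]; exact: key.
pose c := sup A.
exists (\col_i (if i == ik then c else l i 0)) => y sy.
pose z := y - (y ik 0) *: e; pose s := y ik 0.
have sz : supp z.
  have zE i : z i 0 = y i 0 - y ik 0 * (i == ik)%:R by rewrite !mxE eqxx andbT.
  move=> i; rewrite leq_eqVlt zE => /predU1P[ki|ki].
    have -> : i = ik by apply/val_inj.
    by rewrite eqxx mulr1 subrr.
  rewrite sy//; have -> : (i == ik) = false.
    by apply/eqP => ii; move: ki; rewrite ii /= ltnn.
  by rewrite mulr0 subr0.
have yE : y = z + s *: e by rewrite /z subrK.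
have -> : dot (\col_i (if i == ik then c else l i 0)) y = dot l z + s * c.
  rewrite {1}/dot (bigD1 ik)//= mxE eqxx [RHS]addrC mulrC; congr (_ + _).
  rewrite /dot [RHS](bigD1 ik)//= sz ?leqnn// mulr0 add0r.
  apply: eq_bigr => i iik; rewrite !mxE (negbTE iik) /=.
  by rewrite mulr0 subr0.
rewrite [in leRHS]yE; have [s0|s0|s0] := ltgtP s 0.
- have Abd : has_ubound A by exists ((g (0 + 1 *: e) - dot l 0) / 1); exact: Aub.
  have H : (dot l z - g (z - (- s) *: e)) / (- s) <= c.
    by apply: ub_le_sup => //; exists z, (- s); rewrite oppr_gt0.
  move: H; rewrite ler_pdivrMr ?oppr_gt0// scaleNr opprK; lra.
- have : c <= (g (z + s *: e) - dot l z) / s by apply: ge_sup => //; exact: Aub.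
  by rewrite ler_pdivlMr//; lra.
by rewrite s0 scale0r addr0 mul0r addr0; exact: lP.
Qed.

End Subgradients.

(** * Averages at Lebesgue points *)

Section Averages.
Context {R : realType}.
Notation mu := (@lebesgue_measure R).
Implicit Types (f g : R -> R) (t : R).

Definition average f t h := h^-1 * \int[mu]_(s in `[t, t + h]) f s.

(** The primitive starts at -1 so that every [t >= 0], including 0, lies strictly inside the
    interval on which it is differentiated. *)
Lemma average_of_derivative f t : 0 <= t ->
  (forall T, mu.-integrable `[-1, T] (EFin \o f)) ->
  let G y := \int[mu]_(s in `[-1, y]) f s in
  derivable G t 1 -> G^`()%classic t = f t -> average f t h @[h --> 0^'+] --> f t.
Proof.
move=> t0 fi G dG GE; have := dG.
move=> /cvg_dnbhs_at_right; rewrite -[lim _]/('D_1 G t) -derive1E GE.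
apply: cvg_trans; apply: near_eq_cvg; near=> h.
have h0 : 0 < h by near: h; exact: nbhs_right_gt.
rewrite /average /=; congr (_ * _).
rewrite [h *: 1]mulr1 [h + t]addrC /G.
rewrite Rintegral_itvB//; last 2 first.
- by rewrite bnd_simp; lra.
- by rewrite bnd_simp; lra.
rewrite Rintegral_itv_obnd_cbnd//.
by apply: integrableS (fi (t + h)) => //; apply: subset_itv; rewrite bnd_simp; lra.
Unshelve. all: by end_near. Qed.

Lemma average_continuous f t : 0 <= t -> {within `[0, +oo[, continuous f} ->
  average f t h @[h --> 0^'+] --> f t.
Proof.
(* Extending [f] to the left of 0 by the constant [f 0] makes it continuous on the line, so that the
   fundamental theorem also applies at [t = 0]. *)
move=> t0 fc; pose g s := f (Num.max s 0).
have gc : continuous g.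
  have maxc : continuous (fun s : R => Num.max s 0).
    move=> s; apply: (@continuous_max R R id (cst 0) s); first exact: cvg_id.
    exact: cvg_cst.
  move=> s U fU; have max0 r : 0 <= Num.max r 0 :> R by rewrite le_max lexx orbT.
  move/subspace_continuousP: fc => /(_ (Num.max s 0)) /=.
  rewrite in_itv/= max0 => /(_ isT U fU) fc.
  have H : nbhs s ((fun r : R => Num.max r 0) @^-1`
      (fun x => [set` `[0, +oo[] x -> U (f x))) by exact: (maxc s _ fc).
  apply: (filterS _ H) => r /= Ur; apply: Ur.
  by rewrite /= in_itv/= max0.
have gi T : mu.-integrable `[-1, T] (EFin \o g).
  apply: continuous_compact_integrable; first exact: segment_compact.
  by apply: continuous_subspaceT => s; exact: gc.
have gE s : 0 <= s -> g s = f s by move=> s0; rewrite /g max_l.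
have t1 : t < t + 1 by rewrite ltrDl ltr01.
have at1 : (BLeft (-1)%R < BRight t)%E by rewrite /= lte_fin; lra.
have [dG GE] := continuous_FTC1 t1 (gi _) at1 (gc t).
have := average_of_derivative t0 gi dG GE; rewrite gE//.
apply: cvg_trans; apply: near_eq_cvg; near=> h.
rewrite /average; congr (_ * _); apply: eq_Rintegral => s /set_mem /=.
by rewrite in_itv/= => /andP[ts _]; rewrite gE// (le_trans t0).
Unshelve. all: by end_near. Qed.

Lemma average_ae u : good_control u ->
  {ae mu, forall t, 0 <= t -> average u t h @[h --> 0^'+] --> u t}.
Proof.
move=> [mu_u u1].
have ui (K : set R) : measurable K -> (mu K < +oo)%E -> mu.-integrable K (EFin \o u).
  move=> mK Ky; apply: measurable_bounded_integrable => //.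
    exact: measurable_funTS.
  exists 1; split; first exact: num_real.
  by move=> M M1 t _ /=; apply: le_trans (ltW M1); rewrite ler_norml u1.
have uT T : mu.-integrable `[-1, T] (EFin \o u).
  apply: ui => //; rewrite /= lebesgue_measure_itv/=; case: ifP => // _.
  by rewrite -EFinB ltry.
have lu : locally_integrable setT u.
  split=> //; first exact: openT.
  move=> K _ cK; have : mu.-integrable K (EFin \o u).
    by apply: ui; [exact: compact_measurable|exact: compact_finite_measure].
  by case/integrableP.
have := @FTC1 R u (BLeft (-1)) uT lu.
apply: ae_imply => t tP t0; have [|dG GE] := tP; first by rewrite /= lte_fin; lra.
exact: average_of_derivative.
Qed.

End Averages.

(** * The Hamilton-Jacobi equation *)

Section HJB.
Context {R : realType} {n : nat}.
Notation state := 'cV[R]_n.+1.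
Notation mu := (@lebesgue_measure R).
Variable F : state -> R.
Hypothesis Fcont : continuous F.
Hypothesis F0 : F 0 = 0.
Hypothesis Fge0 : forall z, 0 <= F z.
Hypothesis Fconv : forall (a b : R) (z w : state), 0 <= a -> 0 <= b -> a + b = 1 ->
  F (a *: z + b *: w) <= a * F z + b * F w.
Implicit Types (p q l : state) (u v : R -> R) (x y : R -> state).

Notation V := (rvalue F).

Lemma rvalueE p : (V p)%:E = value F p.
Proof. by rewrite /rvalue /= fineK// value_fin. Qed.

Lemma rvalue_convex (a b : R) p q : 0 <= a -> 0 <= b -> a + b = 1 ->
  V (a *: p + b *: q) <= a * V p + b * V q.
Proof.
move=> a0 b0 ab.
have [u [x [[mu_u u1] [sx [adx cx]]]]] := exists_optimal Fcont F0 Fge0 Fconv p.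
have [v [y [[mv v1] [sy [ady cy]]]]] := exists_optimal Fcont F0 Fge0 Fconv q.
have sz T : 0 <= T -> solves T (a *: p + b *: q) (fun t => a * u t + b * v t)
    (fun t => a *: x t + b *: y t).
  by move=> T0; exact: solves_comb (sx T T0) (sy T T0).
have gz : good_control (fun t => a * u t + b * v t).
  split; first by apply: measurable_funD; exact: measurable_funM.
  by move=> t; have /andP[? ?] := u1 t; have /andP[? ?] := v1 t; apply/andP; split; nra.
have adz := solves_admissible gz sz.
rewrite -lee_fin EFinD !EFinM !rvalueE -cx -cy.
apply: (le_trans (value_le_cost F adz)).
apply: cost_convex => //; first exact: admissible_continuous adx.
- exact: admissible_continuous ady.
- exact: admissible_continuous adz.
Qed.

Definition subgradient l p := forall y : state, dot l y <= V (p + y) - V p.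

Lemma subgradientP l p : subgradient l p -> subdifferential (value F) p l.
Proof. by move=> lp y; rewrite -!rvalueE -EFinB lee_fin. Qed.

Lemma subgradient_exists p : exists l, subgradient l p.
Proof.
apply: (@linear_minorant R n (fun y : state => V (p + y) - V p)).
  by rewrite addr0 subrr.
move=> a b y z a0 b0 ab.
have := rvalue_convex (p + y) (p + z) a0 b0 ab.
have -> : a *: (p + y) + b *: (p + z) = p + (a *: y + b *: z).
  by rewrite !scalerDr addrACA -scalerDl ab scale1r.
have : a * V p + b * V p = V p by rewrite -mulrDl ab mul1r.
lra.
Qed.

Lemma dot_velocity l p w :
  dot l (jordan *m p + w *: e_last) = dot l (jordan *m p) + w * l ord_max 0.
Proof. by rewrite dotD dotZ dot_delta. Qed.

(** The subgradient inequality between [x t] and [x (t + h)], where V drops by exactly the running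
    cost, is divided by [h] before letting [h] tend to 0. All averages converge by continuity except
    that of the control, which enters only the last coordinate; [c] is a minorant of that term with
    a known limit, chosen according to what is known of [u] near [t]. *)
Lemma optimal_descent l p u x t (w : R) (c : R -> R) :
  (forall T, 0 <= T -> solves T p u x) -> optimal F p u x -> 0 <= t ->
  subgradient l (x t) ->
  (forall h, 0 < h -> c h <= l ord_max 0 * average u t h) ->
  c h @[h --> 0^'+] --> w * l ord_max 0 ->
  dot l (jordan *m x t + w *: e_last) + F (x t) <= 0.
Proof.
move=> sx op t0 lx cu cw; have [ad _] := op.
have xc := admissible_continuous ad.
pose C (i : 'I_n.+1) h :=
  if (i < n)%N then l i 0 * average (fun s => x s (inord i.+1) 0) t h else c h.
have CF h : 0 < h -> \sum_i C i h + average (F \o x) t h <= 0.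
  move=> h0; have th0 : 0 <= t + h by rewrite addr_ge0// ltW.
  have := lx (x (t + h) - x t); rewrite [x t + _]addrC subrK => xd.
  have := optimal_decrease Fcont Fge0 t0 (ltW h0) op (value_lty Fcont F0 Fge0 _).
  rewrite -!rvalueE -EFinD => -[Vd].
  set I := \int[mu]_(s in _) _ in Vd.
  have {}xd : dot l (x (t + h) - x t) + I <= 0 by rewrite Vd in xd; lra.
  apply: (@le_trans _ _ (h^-1 * (dot l (x (t + h) - x t) + I))); last first.
    by rewrite mulr_ge0_le0// invr_ge0 ltW.
  rewrite mulrDr lerD// /dot mulr_sumr; apply: ler_sum => i _.
  rewrite !mxE (primitiveB (sx _ th0 i))//; last by rewrite lerDl ltW.
  rewrite mulrCA -/(average _ t h) /C; case: ifPn => iN.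
    rewrite /average; under [X in _ <= _ * (_ * X)]eq_Rintegral do rewrite velocityE iN.
    by [].
  have -> : i = ord_max.
    by apply/val_inj/eqP; rewrite eqn_leq -ltnS ltn_ord /= leqNgt.
  apply: (le_trans (cu h h0)); rewrite /average.
  under [X in _ <= _ * (_ * X)]eq_Rintegral do rewrite velocityE ltnn.
  by [].
have Clim i : C i h @[h --> 0^'+] --> l i 0 * velocity (x t) w i.
  rewrite /C velocityE; case: ifPn => iN.
    apply: cvgM; first exact: cvg_cst.
    apply: average_continuous => //.
    exact: (admissible_coord_continuous (i := inord i.+1) ad).
  have -> : i = ord_max.
    by apply/val_inj/eqP; rewrite eqn_leq -ltnS ltn_ord /= leqNgt.
  by rewrite mulrC.
have L : \sum_i C i h + average (F \o x) t h @[h --> 0^'+] -->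
    dot l (jordan *m x t + w *: e_last) + F (x t).
  apply: cvgD.
    rewrite /dot; apply: cvg_big => [z|i _]; last exact: Clim.
    by apply: cvgD; [exact: cvg_fst|exact: cvg_snd].
  exact: (average_continuous t0 (running_cost_continuous Fcont xc)).
apply: (cvgr_to_le L).
near=> h; apply: CF; near: h; exact: nbhs_right_gt.
Unshelve. all: by end_near. Qed.

Lemma average_control_bound u t h : good_control u -> 0 < h -> `|average u t h| <= 1.
Proof.
move=> ug h0; have [mu_u u1] := ug.
have ui : mu.-integrable `[t, t + h] (EFin \o u).
  apply: measurable_bounded_integrable => //.
  - by rewrite /= lebesgue_measure_itv/=; case: ifP => // _; rewrite -EFinB ltry.
  - exact: measurable_funTS.
  exists 1; split; first exact: num_real.
  by move=> M M1 s _ /=; apply: le_trans (ltW M1); rewrite ler_norml u1.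
have oi : mu.-integrable `[t, t + h] (EFin \o cst 1).
  apply: measurable_bounded_integrable => //=.
    by rewrite lebesgue_measure_itv/=; case: ifP => // _; rewrite -EFinB ltry.
  exact: bounded_cst.
rewrite /average normrM gtr0_norm ?invr_gt0// mulrC ler_pdivrMr// mul1r.
apply: (le_trans (le_normr_Rintegral _ ui)) => //.
apply: (@le_trans _ _ (\int[mu]_(s in `[t, t + h]) 1)).
  apply: le_Rintegral => //; first exact: integrable_norm.
  by move=> s _; rewrite ler_norml.
rewrite Rintegral_cst//= lebesgue_measure_itv/= lte_fin ltrDl h0 mul1r /=.
by rewrite addrAC subrr add0r.
Qed.

(** Time 0 of an optimal trajectory from [p] may not be a Lebesgue point of [u]. The averages of [u]
    lie in [-1, 1], so the constant [- |l_n|], attained by [w = - sg l_n], is the minorant passed to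
    [optimal_descent]. *)
Lemma HJ_upper l p : subgradient l p ->
  dot l (jordan *m p) - `|l ord_max 0| + F p <= 0.
Proof.
move=> lp; have [u [x [ug [sx op]]]] := exists_optimal Fcont F0 Fge0 Fconv p.
have x0 : x 0 = p := solves_start (lexx 0) (sx 0 (lexx 0)).
have := @optimal_descent l p u x 0 (- Num.sg (l ord_max 0)) (fun=> - `|l ord_max 0|)
  sx op (lexx 0).
rewrite x0 dot_velocity mulNr -normrEsg; apply => //; last exact: cvg_cst.
move=> h h0; rewrite lerNl; apply: (le_trans (ler_norm _)).
rewrite normrN normrM -[leRHS]mulr1 ler_wpM2l//.
exact: average_control_bound.
Qed.

Lemma poly_left_slope (Q : {poly R}) (c d : R) : 0 < d ->
  (forall h, 0 < h -> h < d -> Q.[- h] - Q.[0] <= h * c) -> - Q^`().[0] <= c.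
Proof.
move=> d0 Qc; have [dQ Qd] := is_derive_poly Q 0.
have : h^-1 *: ((horner Q \o shift 0) (h *: 1) - Q.[0]) @[h --> 0^'-] --> Q^`().[0].
  by apply: cvg_dnbhs_at_left; rewrite -Qd; exact: dQ.
rewrite lerNl => /cvgr_to_ge; apply.
near=> h.
have h0 : h < 0 by near: h; exact: nbhs_left_lt.
have hd : - d < h by near: h; apply: nbhs_left_gt; rewrite oppr_lt0.
have := Qc (- h); rewrite oppr_gt0 opprK => /(_ h0).
rewrite ltrNl => /(_ hd) H; rewrite /= [h *: 1]mulr1 addr0.
rewrite -[leLHS](mulKf (ltr0_neq0 h0)) ler_wnM2l ?invr_le0 ?(ltW h0)//.
by rewrite mulrN -mulNr.
Unshelve. all: by end_near. Qed.

Lemma HJ_lower l p w : -1 <= w <= 1 -> subgradient l p ->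
  0 <= dot l (jordan *m p + w *: e_last) + F p.
Proof.
move=> w1 lp; have [P [P0 Pw]] := flow_jet p w.
pose Q : {poly R} := \sum_i l i 0 *: P^`(i).
have QE t : Q.[t] = dot l (jet P t).
  by rewrite /Q horner_sum; apply: eq_bigr => i _; rewrite hornerZ mxE.
have Q'E : Q^`().[0] = dot l (jordan *m p + w *: e_last).
  rewrite /Q (raddf_sum (@deriv R)) horner_sum; apply: eq_bigr => i _.
  by rewrite /= derivZ hornerZ -derivnS -velocity_jet Pw P0.
have jc (S : {poly R}) : continuous (fun t => jet S t : state).
  move=> t; apply: cvg_col => i.
  rewrite (_ : (fun t => _) = horner S^`(i)); last by apply/funext => s; rewrite mxE.
  by rewrite mxE; exact: continuous_horner.
have Fjc (S : {poly R}) : continuous (fun t => F (jet S t)).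
  by move=> t; apply: (continuous_cvg _ (@Fcont (jet S t))); exact: jc.
rewrite -Q'E -lerBlDl sub0r; apply/ler_addgt0Pr => e e0.
(* Over the last [h < d] units of time before reaching [p], the cost is at most [h * (F p + e)]. *)
have [d /= d0 dF] : exists2 d, 0 < d & forall s, `|s| < d -> F (jet P s) <= F p + e.
  have := Fjc P 0; rewrite /continuous_at P0 => /cvgrPdist_le /(_ _ e0).
  move=> /nbhs_ballP[d /= d0 dF]; exists d => // s sd.
  have := dF s; rewrite /ball /= sub0r normrN => /(_ sd).
  by rewrite ler_distlC => /andP[_]; rewrite addrC.
apply: (poly_left_slope d0) => h h0 hd.
(* Time shifted by [h]: on [0, h] the jet of [S] goes from [jet P (- h)] to [p] under the constant
   control [w]. *)
pose S := P \Po (1 *: 'X + (- h)%:P).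
have SE s : jet S s = jet P (s - h) :> state.
  apply/colP => i; rewrite !mxE derivn_comp_affine expr1n scale1r horner_comp.
  by rewrite !hornerE.
have Sw s : S^`(n.+1).[s] = w.
  by rewrite derivn_comp_affine expr1n scale1r horner_comp Pw.
have mS : measurable_fun (`[0, h] : set R) (fun s => S^`(n.+1).[s]).
  rewrite (_ : (fun s => _) = cst w); first exact: measurable_cst.
  by apply/funext => s; exact: Sw.
have S1 t : 0 <= t <= h -> -1 <= S^`(n.+1).[t] <= 1 by rewrite Sw.
have := dynamic_programming Fcont Fge0 (ltW h0) mS S1 (jet_solves (n := n) S h).
rewrite !SE sub0r subrr P0 -!rvalueE -EFinD lee_fin => dp.
have := lp (jet P (- h) - p); rewrite [p + _]addrC subrK dotB => lh.
rewrite !QE P0; apply: (le_trans lh); apply: (@le_trans _ _ (cost_on F h (jet S))).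
  by rewrite lerBlDr.
have ci : mu.-integrable `[0, h] (EFin \o cst (F p + e)).
  apply: measurable_bounded_integrable => //=.
    by rewrite lebesgue_measure_itv/=; case: ifP => // _; rewrite -EFinB ltry.
  exact: bounded_cst.
apply: (@le_trans _ _ (\int[mu]_(s in `[0, h]) (F p + e))).
  apply: le_Rintegral => //.
    apply: continuous_compact_integrable; first exact: segment_compact.
    by apply: continuous_subspaceT => s; exact: Fjc.
  move=> s /=; rewrite in_itv/= => /andP[s0 sh]; rewrite SE; apply: dF.
  by rewrite ler0_norm; lra.
rewrite Rintegral_cst//= lebesgue_measure_itv/= lte_fin h0 /= subr0.
by rewrite mulrC.
Qed.

Lemma Hamilton_Jacobi l p : subgradient l p ->
  dot l (jordan *m p) - `|l ord_max 0| + F p = 0.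
Proof.
move=> lp; apply/eqP; rewrite eq_le (HJ_upper lp) /=.
have w1 : -1 <= - Num.sg (l ord_max 0) <= 1.
  by case: sgrP => _; apply/andP; split; lra.
have := HJ_lower w1 lp.
by rewrite dot_velocity mulNr -normrEsg.
Qed.

Lemma subgradient_derive l p (v : state) : differentiable V p -> subgradient l p ->
  'D_v V p = dot l v.
Proof.
move=> dV lp; have dv : derivable V p v by exact: diff_derivable.
(* Dividing by [h] bounds the derivative from above as [h] tends to 0 from the left and from below
   as it does from the right. *)
have sub h : V p + h * dot l v <= V (h *: v + p).
  by have := lp (h *: v); rewrite dotZ [p + _]addrC; lra.
apply/eqP; rewrite eq_le; apply/andP; split.
  have /cvgr_to_le := cvg_dnbhs_at_left dv; apply; near=> h.
  have h0 : h < 0 by near: h; exact: nbhs_left_lt.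
  rewrite /= -[leRHS](mulKf (ltr0_neq0 h0)) ler_wnM2l ?invr_le0 ?(ltW h0)//.
  by have := sub h; rewrite lerBrDl.
have /cvgr_to_ge := cvg_dnbhs_at_right dv; apply; near=> h.
have h0 : 0 < h by near: h; exact: nbhs_right_gt.
rewrite /= -[leLHS](mulKf (lt0r_neq0 h0)) ler_wpM2l ?invr_ge0 ?(ltW h0)//.
by have := sub h; rewrite lerBrDl.
Unshelve. all: by end_near. Qed.

Lemma HJB_equation p : differentiable V p ->
  dot (gradient V p) (jordan *m p) - `|'D_e_last V p| + F p = 0.
Proof.
move=> dV; have [l lp] := subgradient_exists p.
have -> : gradient V p = l.
  by apply/colP => i; rewrite mxE (subgradient_derive _ dV lp) dot_delta.
by rewrite (subgradient_derive _ dV lp) dot_delta; exact: Hamilton_Jacobi.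
Qed.

(** For [w] in [-1, 1] the quantity [|a| + w * a] is nonnegative, so the hypothesis is its equality
    case: [w] minimizes the product with [a]. *)
Lemma sign_set_of_min (a w : R) : -1 <= w <= 1 -> `|a| + w * a <= 0 ->
  (-%R @` sign_set a) w.
Proof.
move=> /andP[w1 w2] aw; exists (- w); last exact: opprK.
rewrite /sign_set; case: eqP => [_|/eqP a0] /=.
  by rewrite in_itv/=; apply/andP; split; lra.
have [ap|ap|ap] := ltgtP a 0; last by rewrite ap eqxx in a0.
  have -> : w = 1 by apply/eqP; rewrite eq_le w2 /=; move: aw; rewrite ltr0_norm//; nra.
  by rewrite ltr0_norm// invrN mulrN divff.
have -> : w = -1.
  by apply/eqP; rewrite eq_le w1 andbT; move: aw; rewrite gtr0_norm//; nra.
by rewrite gtr0_norm// divff// opprK.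
Qed.

Lemma optimal_feedback p : exists u x, optimal F p u x /\
  exists ell : R -> state,
    {ae mu, forall t, 0 <= t ->
      subdifferential (value F) (x t) (ell t) /\
      (-%R @` sign_set (ell t ord_max 0)) (u t)}.
Proof.
have [u [x [ug [sx op]]]] := exists_optimal Fcont F0 Fge0 Fconv p.
exists u, x; split => //.
have /choice[ell ellP] : forall t, exists l, subgradient l (x t).
  by move=> t; exact: subgradient_exists.
exists ell; apply: ae_imply (average_ae ug) => t tu t0.
split; first exact: subgradientP.
have [_ /(_ t) ut] := ug; apply: sign_set_of_min ut _.
have cu : ell t ord_max 0 * average u t h @[h --> 0^'+] --> u t * ell t ord_max 0.
  by rewrite [u t * _]mulrC; apply: cvgM; [exact: cvg_cst|exact: tu].
(* At a Lebesgue point the minorant is the control term itself. Subtracting the Hamilton-Jacobi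
   equality from the descent inequality leaves [|l_n| + u t * l_n <= 0]. *)
have := optimal_descent sx op t0 (ellP t) (fun h _ => lexx _) cu.
by rewrite dot_velocity; have := Hamilton_Jacobi (ellP t); lra.
Qed.

End HJB.

Theorem theorem7p5 (R : realType) (n : nat) (F : 'cV[R]_n.+1 -> R)
    (F_C1 : C1 F) (F_convex : convex_function setT F) (F_posdef : posdef F) :
  (forall x : 'cV[R]_n.+1,
    differentiable (rvalue F) x ->
    dot (gradient (rvalue F) x) (jordan *m x)
      - `|'D_e_last (rvalue F) x| + F x = 0) /\
  (forall x0 : 'cV[R]_n.+1,
    exists (u : R -> R) (x : R -> 'cV[R]_n.+1),
      optimal F x0 u x /\
      exists ell : R -> 'cV[R]_n.+1,
        {ae @lebesgue_measure R, forall t, 0 <= t ->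
          subdifferential (value F) (x t) (ell t) /\
          (-%R @` sign_set (ell t ord_max 0)) (u t)}).
Proof.
have [F0 Fpos] := F_posdef.
have Fcont : continuous F.
  by move=> z; apply: differentiable_continuous; case: F_C1 => dF _; exact: dF.
have Fge0 z : 0 <= F z.
  by have [->|z0] := eqVneq z 0; [rewrite F0|exact/ltW/Fpos].
have Fconv (a b : R) (z w : 'cV[R]_n.+1) : 0 <= a -> 0 <= b -> a + b = 1 ->
    F (a *: z + b *: w) <= a * F z + b * F w.
  move=> a0 b0 ab.
  have a1 : a <= 1 by lra.
  have bE : b = 1 - a by lra.
  have := F_convex (Itv01 a0 a1) z w (in_setT _) (in_setT _).
  by rewrite bE.
split=> [x dx|x0]; first exact: HJB_equation.
exact: optimal_feedback.
Qed.
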